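(* Let $E\to M$ be a complex Hermitian vector bundle with $k$-dimensional fibers, $k\ge1$, over a smooth manifold $M$. Then $\Gamma^\infty(E)$ is a $(\Gamma^\infty(\mathrm{End}(E))$-$C^\infty(M))$-equivalence bimodule.
   Context: $M$ is a finite-dimensional smooth manifold (not assumed compact), $E\to M$ a smooth complex vector bundle with Hermitian fiber metric $h$ (linear in the second argument), and $\Gamma^\infty(E)$, $\Gamma^\infty(\mathrm{End}(E))$ denote smooth sections. $C^\infty(M)$ (complex-valued smooth functions) is a $^*$-algebra under complex conjugation, and $\Gamma^\infty(\mathrm{End}(E))$ is a $^*$-algebra under the fiberwise adjoint with respect to $h$. $\Gamma^\infty(E)$ is a $(\Gamma^\infty(\mathrm{End}(E))$-$C^\infty(M))$-bimodule in the obvious way, with the $C^\infty(M)$-valued inner product $(u,v)\mapsto h(u,v)$ and the $\Gamma^\infty(\mathrm{End}(E))$-valued inner product $(u,v)\mapsto\Theta_{u,v}$, where $\Theta_{u,v}(w)=u\cdot h(v,w)$. Equivalence bimodules (for complex $^*$-algebras). A complex pre-Hilbert space $\mathfrak H$ is a complex vector space with positive-definite Hermitian product, linear in the second argument; $\mathfrak B(\mathfrak H)$ is the $^*$-algebra of all linear maps $\mathfrak H\to\mathfrak H$ having an adjoint on $\mathfrak H$. A $^*$-representation of $\mathcal A$ is a $^*$-homomorphism $\pi:\mathcal A\to\mathfrak B(\mathfrak H)$. A linear functional $\omega$ on $\mathcal A$ is positive if $\omega(A^*A)\ge0$ for all $A$; $\mathcal A^+$ is the set of Hermitian $A$ with $\omega(A)\ge0$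 for all positive $\omega$. An $\mathcal A$-valued inner product on a right $\mathcal A$-module $\mathfrak X$ (with compatible $\mathbb C$-vector space structure) is a map $\langle\cdot,\cdot\rangle_{\mathcal A}$, $\mathbb C$- and right $\mathcal A$-linear in the second argument, with $\langle x,y\rangle_{\mathcal A}=\langle y,x\rangle_{\mathcal A}^*$. It is positive semi-definite if $\langle x,x\rangle_{\mathcal A}\in\mathcal A^+$, and full if the span of all $\langle x,y\rangle_{\mathcal A}$ is $\mathcal A$. For a left $\mathcal B$-module, ${}_{\mathcal B}\langle\cdot,\cdot\rangle$ is analogous with linearity in the first argument. A $(\mathcal B$-$\mathcal A)$-equivalence bimodule is a $(\mathcal B$-$\mathcal A)$-bimodule $\mathfrak X$ with full positive semi-definite inner products $\langle\cdot,\cdot\rangle_{\mathcal A}$ and ${}_{\mathcal B}\langle\cdot,\cdot\rangle$ such that: $\langle B\cdot x,y\rangle_{\mathcal A}=\langle x,B^*\cdot y\rangle_{\mathcal A}$ and ${}_{\mathcal B}\langle x\cdot A,y\rangle={}_{\mathcal B}\langle x,y\cdot A^*\rangle$; $x\cdot\langle y,z\rangle_{\mathcal A}={}_{\mathcal B}\langle x,y\rangle\cdot z$; property P: for every $^*$-representation $(\pi,\mathfrak H)$ of $\mathcal A$ the Hermitian product on $\mathfrak X\otimes_{\mathcal A}\mathfrak H$ determined by $\langle x\otimes\psi,y\otimes\phi\rangle=\langle\psi,\pi(\langle x,y\rangle_{\mathcal A})\phi\rangle_{\mathfrak H}$ is positive semi-definite; property Q: the conjugate $(\mathcal A$-$\mathcal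 B)$-bimodule $\overline{\mathfrak X}$ (same additive group, elements $\overline x$, with $z\overline x=\overline{\overline zx}$, $A\cdot\overline x=\overline{x\cdot A^*}$, $\overline x\cdot B=\overline{B^*\cdot x}$, $\langle\overline x,\overline y\rangle_{\mathcal B}={}_{\mathcal B}\langle x,y\rangle$) has property P with respect to $\mathcal B$. *)

(* Defs.v *)
From HB Require Import structures.
From mathcomp Require Import all_boot all_order all_algebra generic_quotient.
From mathcomp Require Import all_classical all_reals all_analysis complex.

Set Implicit Arguments.
Unset Strict Implicit.
Unset Printing Implicit Defensive.

Import Order.TTheory GRing.Theory Num.Theory numFieldNormedType.Exports.

Local Open Scope quotient_scope.
Local Open Scope classical_set_scope.
Local Open Scope ring_scope.

(** * Algebraic equivalence bimodules

    [C] is the field of scalars; it is instantiated with the complex numbers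
    [R[i]] below. *)

(* Associative *-algebras, not required to have a unit. *)
Record starAlgebra (C : numClosedFieldType) := StarAlgebra {
  sa_car :> lmodType C;
  sa_mul : sa_car -> sa_car -> sa_car;
  sa_star : sa_car -> sa_car;
  sa_mulA : forall a b c, sa_mul a (sa_mul b c) = sa_mul (sa_mul a b) c;
  sa_mulDl : forall a b c, sa_mul (a + b) c = sa_mul a c + sa_mul b c;
  sa_mulDr : forall a b c, sa_mul a (b + c) = sa_mul a b + sa_mul a c;
  sa_mulZl : forall (z : C) a b, sa_mul (z *: a) b = z *: sa_mul a b;
  sa_mulZr : forall (z : C) a b, sa_mul a (z *: b) = z *: sa_mul a b;
  sa_starK : forall a, sa_star (sa_star a) = a;
  sa_starD : forall a b, sa_star (a + b) = sa_star a + sa_star b;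
  sa_starZ : forall (z : C) a, sa_star (z *: a) = z^* *: sa_star a;
  sa_starM : forall a b, sa_star (sa_mul a b) = sa_mul (sa_star b) (sa_star a)
}.

Notation "a ** b" := (sa_mul a b) (at level 40, left associativity) : ring_scope.
Notation "a ^†" := (sa_star a) (at level 2, format "a ^†") : ring_scope.

Definition positive_functional (C : numClosedFieldType) (A : starAlgebra C)
    (w : {scalar A}) : Prop :=
  forall a : A, 0 <= w (a^† ** a).

(* The set A^+. *)
Definition algebra_positive (C : numClosedFieldType) (A : starAlgebra C) :
    set A :=
  [set a | a^† = a /\
    forall w : {scalar A}, positive_functional w -> 0 <= w a].

Record preHilbert (C : numClosedFieldType) := PreHilbert {
  ph_car :> lmodType C;
  ph_ip : ph_car -> ph_car -> C;
  ph_ipD : forall x y z, ph_ip x (y + z) = ph_ip x y + ph_ip x z;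
  ph_ipZ : forall (c : C) x y, ph_ip x (c *: y) = c * ph_ip x y;
  ph_ip_herm : forall x y, ph_ip x y = (ph_ip y x)^*;
  ph_ip_pos : forall x, x != 0 -> 0 < ph_ip x x
}.

(* *-homomorphisms from A to the *-algebra of adjointable linear endomorphisms
   of H.  The last field says that each [rep_map a] has the adjoint
   [rep_map a^†].  No unit is required to be preserved. *)
Record starRepresentation (C : numClosedFieldType) (A : starAlgebra C)
    (H : preHilbert C) := StarRepresentation {
  rep_map :> A -> {linear H -> H};
  rep_mapD : forall a b v, rep_map (a + b) v = rep_map a v + rep_map b v;
  rep_mapZ : forall (z : C) a v, rep_map (z *: a) v = z *: rep_map a v;
  rep_mapM : forall a b v, rep_map (a ** b) v = rep_map a (rep_map b v);
  rep_map_star : forall a v w,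
    ph_ip (rep_map a v) w = ph_ip v (rep_map a^† w)
}.

(* (B-A)-bimodules with compatible C-vector space structure.  When B (resp. A)
   happens to have a unit, the module is unital. *)
Record bimodule (C : numClosedFieldType) (B A : starAlgebra C) := Bimodule {
  bm_car :> lmodType C;
  bm_lact : B -> bm_car -> bm_car;
  bm_ract : bm_car -> A -> bm_car;
  bm_lactD : forall b x y, bm_lact b (x + y) = bm_lact b x + bm_lact b y;
  bm_lactDl : forall b c x, bm_lact (b + c) x = bm_lact b x + bm_lact c x;
  bm_lactZ : forall (z : C) b x, bm_lact b (z *: x) = z *: bm_lact b x;
  bm_lactZl : forall (z : C) b x, bm_lact (z *: b) x = z *: bm_lact b x;
  bm_lactM : forall b c x, bm_lact (b ** c) x = bm_lact b (bm_lact c x);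
  bm_lact1 : forall e : B, (forall b : B, e ** b = b /\ b ** e = b) ->
    forall x, bm_lact e x = x;
  bm_ractD : forall x y a, bm_ract (x + y) a = bm_ract x a + bm_ract y a;
  bm_ractDr : forall x a c, bm_ract x (a + c) = bm_ract x a + bm_ract x c;
  bm_ractZ : forall (z : C) x a, bm_ract (z *: x) a = z *: bm_ract x a;
  bm_ractZr : forall (z : C) x a, bm_ract x (z *: a) = z *: bm_ract x a;
  bm_ractM : forall x a c, bm_ract x (a ** c) = bm_ract (bm_ract x a) c;
  bm_ract1 : forall e : A, (forall a : A, e ** a = a /\ a ** e = a) ->
    forall x, bm_ract x e = x;
  bm_actA : forall b x a, bm_ract (bm_lact b x) a = bm_lact b (bm_ract x a)
}.

Notation "b *> x" := (bm_lact b x) (at level 40, left associativity) : ring_scope.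
Notation "x <* a" := (bm_ract x a) (at level 40, left associativity) : ring_scope.

(** ** The conjugate bimodule *)

Definition conj_space (C : numClosedFieldType) (X : lmodType C) : Type := X.

HB.instance Definition _ (C : numClosedFieldType) (X : lmodType C) :=
  GRing.Zmodule.on (conj_space X).

Section ConjSpace.
Variables (C : numClosedFieldType) (X : lmodType C).

Definition conj_scale (z : C) (x : conj_space X) : conj_space X :=
  (z^* *: (x : X)).

Fact conj_scaleA a b x : conj_scale a (conj_scale b x) = conj_scale (a * b) x.
Proof. by rewrite /conj_scale scalerA rmorphM. Qed.

Fact conj_scale1 : left_id 1 conj_scale.
Proof. by move=> x; rewrite /conj_scale rmorph1 scale1r. Qed.

Fact conj_scaleDr : right_distributive conj_scale +%R.
Proof. by move=> a x y; exact: (scalerDr a^* (x : X) (y : X)). Qed.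

Fact conj_scaleDl x : {morph conj_scale^~ x : a b / a + b}.
Proof. by move=> a b; rewrite /conj_scale rmorphD; exact: scalerDl. Qed.

HB.instance Definition _ := GRing.Zmodule_isLmodule.Build C (conj_space X)
  conj_scaleA conj_scale1 conj_scaleDr conj_scaleDl.
End ConjSpace.

Section ConjBimodule.
Variables (C : numClosedFieldType) (B A : starAlgebra C) (X : bimodule B A).

Let lact (a : A) (x : conj_space X) : conj_space X := (x : X) <* a^†.
Let ract (x : conj_space X) (b : B) : conj_space X := b^† *> (x : X).

Lemma star_unit (D : starAlgebra C) (e : D) :
  (forall a : D, e ** a = a /\ a ** e = a) ->
  forall a : D, e^† ** a = a /\ a ** e^† = a.
Proof.
move=> he a; have [h1 h2] := he a^†; split.
  by have := congr1 (@sa_star _ D) h2; rewrite sa_starM sa_starK.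
by have := congr1 (@sa_star _ D) h1; rewrite sa_starM sa_starK.
Qed.

Definition conj_bimodule : bimodule A B.
Proof.
refine (@Bimodule C A B (conj_space X) lact ract
  _ _ _ _ _ _ _ _ _ _ _ _ _); rewrite /lact /ract.
- by move=> b x y; exact: (@bm_ractD _ _ _ X).
- by move=> b c x; rewrite sa_starD; exact: (@bm_ractDr _ _ _ X).
- by move=> z b x; exact: (@bm_ractZ _ _ _ X).
- by move=> z b x; rewrite sa_starZ; exact: (@bm_ractZr _ _ _ X).
- by move=> b c x; rewrite sa_starM; exact: (@bm_ractM _ _ _ X).
- by move=> e he x; apply: (@bm_ract1 _ _ _ X); exact: star_unit.
- by move=> x y a; exact: (@bm_lactD _ _ _ X).
- by move=> x a c; rewrite sa_starD; exact: (@bm_lactDl _ _ _ X).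
- by move=> z x a; exact: (@bm_lactZ _ _ _ X).
- by move=> z x a; rewrite sa_starZ; exact: (@bm_lactZl _ _ _ X).
- by move=> x a c; rewrite sa_starM; exact: (@bm_lactM _ _ _ X).
- by move=> e he x; apply: (@bm_lact1 _ _ _ X); exact: star_unit.
- by move=> b x a; rewrite bm_actA.
Defined.
End ConjBimodule.

(** ** The tensor product X (x)_A H *)

Section Tensor.
Variables (C : numClosedFieldType) (B A : starAlgebra C) (X : bimodule B A).
Variables (H : preHilbert C) (rho : starRepresentation A H).

(* A list of pairs [:: (x1, v1); ...; (xm, vm)] stands for the finite sum of
   the elementary tensors [xi (x) vi]; [tensor_eq] is the least additive
   congruence on such sums that contains the relations of X (x)_A H. *)
Inductive tensor_eq : seq (X * H) -> seq (X * H) -> Prop :=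
| tensor_refl s : tensor_eq s s
| tensor_sym s t : tensor_eq s t -> tensor_eq t s
| tensor_trans s t u : tensor_eq s t -> tensor_eq t u -> tensor_eq s u
| tensor_cat s s' t t' :
    tensor_eq s s' -> tensor_eq t t' -> tensor_eq (s ++ t) (s' ++ t')
| tensor_catC s t : tensor_eq (s ++ t) (t ++ s)
| tensor_zero v : tensor_eq [:: (0, v)] [::]
| tensor_addl x y v : tensor_eq [:: (x + y, v)] [:: (x, v); (y, v)]
| tensor_addr x v w : tensor_eq [:: (x, v + w)] [:: (x, v); (x, w)]
| tensor_scale (z : C) x v : tensor_eq [:: (z *: x, v)] [:: (x, z *: v)]
| tensor_bal a x v : tensor_eq [:: (x <* a, v)] [:: (x, rho a v)].

Definition tensor_eqb : rel (seq (X * H)) := fun s t => `[< tensor_eq s t >].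

Fact tensor_eqb_equiv : equiv_class_of tensor_eqb.
Proof.
split.
- by move=> s; apply/asboolP; exact: tensor_refl.
- by move=> s t; apply/asboolP/asboolP; exact: tensor_sym.
- move=> t s u /asboolP st /asboolP tu; apply/asboolP.
  exact: tensor_trans st tu.
Qed.

Canonical tensor_equiv := EquivRelPack tensor_eqb_equiv.

Definition tensor : Type := {eq_quot tensor_equiv}.

HB.instance Definition _ := Choice.on tensor.
HB.instance Definition _ := EqQuotient.on tensor.

Definition elt_tensor (x : X) (v : H) : tensor := \pi_tensor [:: (x, v)].

Let scale_seq (z : C) (s : seq (X * H)) := [seq (z *: p.1, p.2) | p <- s].

Let tadd (s t : tensor) : tensor := \pi_tensor (repr s ++ repr t).
Let tzero : tensor := \pi_tensor [::].
Let tscale (z : C) (s : tensor) : tensor := \pi_tensor (scale_seq z (repr s)).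
Let topp (s : tensor) : tensor := tscale (-1) s.

Lemma tensor_ind (P : tensor -> Prop) :
  (forall s, P (\pi_tensor s)) -> forall t, P t.
Proof. by move=> h t; rewrite -[t]reprK. Qed.

Lemma tensor_pi_eq s t : (\pi_tensor s = \pi_tensor t) <-> tensor_eq s t.
Proof.
split; first by move/eqmodP/asboolP.
by move=> st; apply/eqmodP/asboolP.
Qed.

Lemma tensor_repr s : tensor_eq (repr (\pi_tensor s)) s.
Proof. by apply/tensor_pi_eq; rewrite reprK. Qed.

Lemma scale_seq_eq z s t :
  tensor_eq s t -> tensor_eq (scale_seq z s) (scale_seq z t).
Proof.
elim=> {s t}.
- by move=> s; exact: tensor_refl.
- by move=> s t _; exact: tensor_sym.
- by move=> s t u _ h1 _; exact: tensor_trans.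
- by move=> s s' t t' _ h1 _ h2; rewrite /scale_seq !map_cat; exact: tensor_cat.
- by move=> s t; rewrite /scale_seq !map_cat; exact: tensor_catC.
- by move=> v /=; rewrite scaler0; exact: tensor_zero.
- by move=> x y v /=; rewrite scalerDr; exact: tensor_addl.
- by move=> x v w /=; exact: tensor_addr.
- by move=> c x v /=; rewrite scalerA mulrC -scalerA; exact: tensor_scale.
- by move=> a x v /=; rewrite -bm_ractZ; exact: tensor_bal.
Qed.

Lemma tensor_piD s t : tadd (\pi_tensor s) (\pi_tensor t) = \pi_tensor (s ++ t).
Proof. by apply/tensor_pi_eq; apply: tensor_cat; exact: tensor_repr. Qed.

Lemma tensor_piZ z s : tscale z (\pi_tensor s) = \pi_tensor (scale_seq z s).
Proof. by apply/tensor_pi_eq; apply: scale_seq_eq; exact: tensor_repr. Qed.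

Fact taddA : associative tadd.
Proof.
elim/tensor_ind=> s; elim/tensor_ind=> t; elim/tensor_ind=> u.
by rewrite !tensor_piD catA.
Qed.

Fact taddC : commutative tadd.
Proof.
elim/tensor_ind=> s; elim/tensor_ind=> t; rewrite !tensor_piD; apply/tensor_pi_eq.
exact: tensor_catC.
Qed.

Fact tadd0 : left_id tzero tadd.
Proof. by elim/tensor_ind=> s; rewrite tensor_piD. Qed.

Fact tscaleDl s : {morph tscale^~ s : a b / a + b >-> tadd a b}.
Proof.
elim/tensor_ind: s => s a b; rewrite !tensor_piZ tensor_piD; apply/tensor_pi_eq.
elim: s => [|[x v] s ih] /=; first exact: tensor_refl.
rewrite -cat1s; apply: tensor_trans.
  apply: tensor_cat; [rewrite scalerDl; exact: tensor_addl|exact: ih].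
have := tensor_cat (tensor_refl [:: (a *: x, v)]) (tensor_cat
  (tensor_catC [:: (b *: x, v)] (scale_seq a s)) (tensor_refl (scale_seq b s))).
by rewrite /= -catA.
Qed.

Fact tscaleDr : right_distributive tscale tadd.
Proof.
move=> a; elim/tensor_ind=> s; elim/tensor_ind=> t.
by rewrite !(tensor_piZ, tensor_piD) /scale_seq map_cat.
Qed.

Fact tscaleA a b s : tscale a (tscale b s) = tscale (a * b) s.
Proof.
elim/tensor_ind: s => s; rewrite !tensor_piZ /scale_seq -map_comp; congr (\pi_tensor _).
by apply: eq_map => -[x v] /=; rewrite scalerA.
Qed.

Fact tscale1 : left_id 1 tscale.
Proof.
elim/tensor_ind=> s; rewrite tensor_piZ /scale_seq; congr (\pi_tensor _).
by rewrite -[RHS]map_id; apply: eq_map => -[x v] /=; rewrite scale1r.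
Qed.

Fact tscale0 s : tscale 0 s = tzero.
Proof.
elim/tensor_ind: s => s; rewrite tensor_piZ; apply/tensor_pi_eq.
elim: s => [|[x v] s ih] /=; first exact: tensor_refl.
rewrite scale0r -cat1s -[[::]]cats0; apply: tensor_cat => //.
exact: tensor_zero.
Qed.

Fact taddN : left_inverse tzero topp tadd.
Proof.
by move=> s; rewrite -[X in tadd _ X]tscale1 /topp -tscaleDl addNr tscale0.
Qed.

HB.instance Definition _ := GRing.isZmodule.Build tensor taddA taddC tadd0 taddN.

HB.instance Definition _ := GRing.Zmodule_isLmodule.Build C tensor
  tscaleA tscale1 tscaleDr tscaleDl.

End Tensor.

Notation "x '(x)_' rho v" := (elt_tensor rho x v)
  (at level 40, rho at level 9, v at level 9, format "x  '(x)_' rho  v") : ring_scope.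

(** ** Inner products and equivalence bimodules *)

Section EquivalenceBimodule.
Variables (C : numClosedFieldType).

(* A-valued, linear in the second argument. *)
Record right_inner_product (B A : starAlgebra C) (X : bimodule B A)
    (ip : X -> X -> A) : Prop := RightInnerProduct {
  rip_add : forall x y z, ip x (y + z) = ip x y + ip x z;
  rip_scale : forall (c : C) x y, ip x (c *: y) = c *: ip x y;
  rip_act : forall x y a, ip x (y <* a) = ip x y ** a;
  rip_star : forall x y, ip x y = (ip y x)^†
}.

(* B-valued, linear in the first argument. *)
Record left_inner_product (B A : starAlgebra C) (X : bimodule B A)
    (ip : X -> X -> B) : Prop := LeftInnerProduct {
  lip_add : forall x y z, ip (x + y) z = ip x z + ip y z;
  lip_scale : forall (c : C) x y, ip (c *: x) y = c *: ip x y;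
  lip_act : forall b x y, ip (b *> x) y = b ** ip x y;
  lip_star : forall x y, ip x y = (ip y x)^†
}.

Definition ip_psd (X : Type) (D : starAlgebra C) (ip : X -> X -> D) : Prop :=
  forall x, algebra_positive (ip x x).

Definition ip_full (X : Type) (D : starAlgebra C) (ip : X -> X -> D) : Prop :=
  forall d : D, exists s : seq (C * (X * X)),
    d = \sum_(p <- s) p.1 *: ip p.2.1 p.2.2.

Record hermitian_product (V : lmodType C) (F : V -> V -> C) : Prop :=
  HermitianProduct {
    hp_add : forall x y z, F x (y + z) = F x y + F x z;
    hp_scale : forall (c : C) x y, F x (c *: y) = c * F x y;
    hp_herm : forall x y, F x y = (F y x)^*
  }.

(* Elementary tensors span, so the form [F] is unique. *)
Definition property_P (B A : starAlgebra C) (X : bimodule B A)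
    (ip : X -> X -> A) : Prop :=
  forall (H : preHilbert C) (rho : starRepresentation A H),
  exists F : tensor X rho -> tensor X rho -> C,
    [/\ hermitian_product F,
        forall x v y w,
          F (x (x)_rho v) (y (x)_rho w) = ph_ip v (rho (ip x y) w) &
        forall t, 0 <= F t t].

Definition property_Q (B A : starAlgebra C) (X : bimodule B A)
    (ip : X -> X -> B) : Prop :=
  @property_P A B (conj_bimodule X) (fun x y => ip x y).

Record equivalence_bimodule (B A : starAlgebra C) (X : bimodule B A)
    (ipA : X -> X -> A) (ipB : X -> X -> B) : Prop := EquivalenceBimodule {
  eb_ipA : right_inner_product ipA;
  eb_ipB : left_inner_product ipB;
  eb_psdA : ip_psd ipA;
  eb_psdB : ip_psd ipB;
  eb_fullA : ip_full ipA;
  eb_fullB : ip_full ipB;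
  eb_adjA : forall b x y, ipA (b *> x) y = ipA x (b^† *> y);
  eb_adjB : forall x y a, ipB (x <* a) y = ipB x (y <* a^†);
  eb_compat : forall x y z, x <* ipA y z = ipB x y *> z;
  eb_P : property_P ipA;
  eb_Q : property_Q ipB
}.

End EquivalenceBimodule.

(** * Smooth functions *)

Section SmoothRn.
Variables (R : realType) (n : nat).
Implicit Types (W : set 'rV[R]_n) (f g : 'rV[R]_n -> R).

(* [f] is of class C^k on the open set [W]: all iterated partial derivatives
   of order at most [k] exist and are continuous at the points of [W]. *)
Fixpoint Ck (k : nat) W f : Prop :=
  (forall x, W x -> {for x, continuous f}) /\
  match k with
  | 0 => True
  | k'.+1 => forall i : 'I_n,
      (forall x, W x -> derivable f x (delta_mx 0 i)) /\
      Ck k' W (fun x => 'D_(delta_mx 0 i) f x)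
  end.

Definition smoothRn W f : Prop := forall k, Ck k W f.

Lemma Ck_cont k W f x : Ck k W f -> W x -> {for x, continuous f}.
Proof. by case: k => [|k] [] => cf _; exact: cf. Qed.

Lemma Ck_ext k W f g : open W -> (forall x, W x -> f x = g x) ->
  Ck k W f -> Ck k W g.
Proof.
move=> oW; elim: k f g => [|k ih] f g fg /= [cf Hf].
all: have nfg x : W x -> {near x, f =1 g} by
  move=> Wx; have := open_nbhs_nbhs (conj oW Wx); apply: filterS => y /fg.
all: split => //.
1,2: move=> x Wx; have := cf _ Wx; rewrite /prop_for /continuous_at (fg _ Wx);
  exact: cvg_trans (near_eq_cvg (nfg _ Wx)).
move=> i; have [df Cf] := Hf i.
split=> [x Wx|]; first by apply: near_eq_derivable (df _ Wx); exact: nfg.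
by apply: ih Cf => x Wx; apply: near_eq_derive; exact: nfg.
Qed.

Lemma Ck_sub k W W' f : W' `<=` W -> Ck k W f -> Ck k W' f.
Proof.
move=> sW; elim: k f => [|k ih] f /= [cf Hf]; split => //.
1,2: by move=> x /sW; exact: cf.
move=> i; have [df Cf] := Hf i.
by split; [move=> x /sW; exact: df|exact: ih].
Qed.

Lemma Ck_bigcup k (I : Type) (P : set I) (V : I -> set 'rV[R]_n) f :
  (forall i, P i -> Ck k (V i) f) -> Ck k (\bigcup_(i in P) V i) f.
Proof.
elim: k f => [|k ih] f Hf /=; split => //.
1,2: by move=> x [i Pi Vx]; exact: Ck_cont (Hf i Pi) Vx.
move=> j; split; first by move=> x [i Pi Vx]; have [_ /(_ j)[+ _]] := Hf i Pi; exact.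
by apply: ih => i Pi; have [_ /(_ j)[]] := Hf i Pi.
Qed.

Lemma Ck_prev k W f : Ck k.+1 W f -> Ck k W f.
Proof.
elim: k f => [|k ih] f /= [cf Hf]; split => // i.
have [df Cf] := Hf i; split => //; exact: ih.
Qed.

Lemma Ck_cst k W (c : R) : Ck k W (fun=> c).
Proof.
elim: k c => [|k ih] c /=; split => //.
1,2: by move=> x _; exact: cst_continuous.
move=> i; split=> [x _|]; first exact: derivable_cst.
have e : 'D_(delta_mx 0 i) (fun=> c) = (fun=> 0) :> ('rV[R]_n -> R).
  by rewrite funeqE => x; exact: derive_cst.
by rewrite [X in Ck k W X]e; exact: ih.
Qed.

Lemma CkD k W f g : open W -> Ck k W f -> Ck k W g ->
  Ck k W (fun x => f x + g x).
Proof.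
move=> oW; elim: k f g => [|k ih] f g /= [cf Hf] [cg Hg]; split => //.
1,2: by move=> x Wx; exact: (continuousD (cf _ Wx) (cg _ Wx)).
move=> i; have [df Cf] := Hf i; have [dg Cg] := Hg i.
split; first by move=> x Wx; apply: derivableD; [exact: df|exact: dg].
apply: Ck_ext oW _ (ih _ _ Cf Cg) => x Wx.
by rewrite -[RHS]/('D_(delta_mx 0 i) (f + g) x) deriveD//; [exact: df|exact: dg].
Qed.

Lemma CkN k W f : open W -> Ck k W f -> Ck k W (fun x => - f x).
Proof.
move=> oW; elim: k f => [|k ih] f /= [cf Hf]; split => //.
1,2: by move=> x Wx; exact: (continuousN (cf _ Wx)).
move=> i; have [df Cf] := Hf i.
split; first by move=> x Wx; apply: derivableN; exact: df.
apply: Ck_ext oW _ (ih _ Cf) => x Wx.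
by rewrite -[RHS]/('D_(delta_mx 0 i) (- f) x) deriveN//; exact: df.
Qed.

Lemma CkM k W f g : open W -> Ck k W f -> Ck k W g ->
  Ck k W (fun x => f x * g x).
Proof.
move=> oW; elim: k f g => [|k ih] f g hf hg; split => //.
1,2: by move=> x Wx; exact: (continuousM (Ck_cont hf Wx) (Ck_cont hg Wx)).
move=> i; have [_ /(_ i)[df Cf]] := hf; have [_ /(_ i)[dg Cg]] := hg.
split; first by move=> x Wx; apply: derivableM; [exact: df|exact: dg].
apply: Ck_ext oW _ (CkD oW (ih _ _ (Ck_prev hf) Cg) (ih _ _ (Ck_prev hg) Cf)).
move=> x Wx.
by rewrite -[RHS]/('D_(delta_mx 0 i) (f * g) x) deriveM//; [exact: df|exact: dg].
Qed.

Lemma CkV k W f : open W -> (forall x, W x -> f x != 0) -> Ck k W f ->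
  Ck k W (fun x => (f x)^-1).
Proof.
move=> oW f0; elim: k => [|k ih] hf; split => //.
1,2: by move=> x Wx; exact: (continuousV (f0 _ Wx) (Ck_cont hf Wx)).
move=> i; have [_ /(_ i)[df Cf]] := hf.
split; first by move=> x Wx; apply: derivableV; [exact: f0|exact: df].
have ih' := ih (Ck_prev hf).
apply: Ck_ext oW _ (CkM oW (CkN oW (CkM oW ih' ih')) Cf) => x Wx /=.
rewrite (deriveV (f0 _ Wx) (df _ Wx)).
by rewrite -exprVn expr2.
Qed.

End SmoothRn.

(** * Manifolds *)

Record chart (R : realType) (n : nat) (M : topologicalType) := Chart {
  ch_dom : set M;
  ch_map : M -> 'rV[R]_n;
  ch_inv : 'rV[R]_n -> M;
  ch_dom_open : open ch_dom;
  ch_img_open : open (ch_map @` ch_dom);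
  ch_mapK : forall x, ch_dom x -> ch_inv (ch_map x) = x;
  ch_map_cont : forall x, ch_dom x -> {for x, continuous ch_map};
  ch_inv_cont : forall y, (ch_map @` ch_dom) y -> {for y, continuous ch_inv}
}.

(* Smooth manifolds of dimension n; the atlas need not be maximal. *)
Record smoothManifold (R : realType) (n : nat) := SmoothManifold {
  mf_top :> topologicalType;
  mf_hausdorff : hausdorff_space mf_top;
  mf_second_countable : @second_countable mf_top;
  mf_atlas : set (chart R n mf_top);
  mf_cover : forall x, exists2 c, mf_atlas c & ch_dom c x;
  mf_compat : forall c d, mf_atlas c -> mf_atlas d -> forall i : 'I_n,
    smoothRn (ch_map c @` (ch_dom c `&` ch_dom d))
      (fun y => ch_map d (ch_inv c y) 0 i)
}.

Section SmoothManifoldFunctions.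
Variables (R : realType) (n : nat) (M : smoothManifold R n).
Implicit Types (U : set M) (f g : M -> R[i]).

(* Smoothness of a complex-valued function on an open subset of M. *)
Definition smooth_on U f : Prop :=
  forall c, mf_atlas c ->
    smoothRn (ch_map c @` (ch_dom c `&` U)) (fun y => complex.Re (f (ch_inv c y)))
    /\
    smoothRn (ch_map c @` (ch_dom c `&` U)) (fun y => complex.Im (f (ch_inv c y))).

Lemma chart_image_open (c : chart R n M) U :
  open U -> open (ch_map c @` (ch_dom c `&` U)).
Proof.
move=> oU; apply/interior_id/seteqP; split; first exact: interior_subset.
move=> _ [x [cx Ux] <-]; rewrite /interior.
have Wx : (ch_map c @` ch_dom c) (ch_map c x) by exists x.
have h1 := open_nbhs_nbhs (conj (@ch_img_open _ _ _ c) Wx).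
have h2 := ch_inv_cont Wx.
have /h2 h3 : nbhs (ch_inv c (ch_map c x)) U.
  by rewrite ch_mapK//; exact: open_nbhs_nbhs.
apply: filterS2 h1 h3 => y [z cz <-] /=; rewrite /preimage /= ch_mapK// => Uz.
by exists z.
Qed.

Lemma smooth_on_ext U f g : open U -> (forall x, U x -> f x = g x) ->
  smooth_on U f -> smooth_on U g.
Proof.
move=> oU fg hf c Ac; have [h1 h2] := hf c Ac.
have oW := @chart_image_open c _ oU.
by split=> k; [apply: Ck_ext oW _ (h1 k)|apply: Ck_ext oW _ (h2 k)];
  move=> _ [x [cx Ux] <-]; rewrite ch_mapK// fg.
Qed.

Lemma smooth_on_sub U V f : V `<=` U -> smooth_on U f -> smooth_on V f.
Proof.
move=> VU hf c Ac; have [h1 h2] := hf c Ac.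
by split=> k; [have := h1 k|have := h2 k]; apply: Ck_sub => _ [x [cx Ux] <-];
  exists x => //; split => //; exact: VU.
Qed.

Lemma smooth_on_cover (I : Type) (P : set I) (V : I -> set M) f :
  (forall i, P i -> smooth_on (V i) f) -> smooth_on (\bigcup_(i in P) V i) f.
Proof.
move=> hf c Ac.
have -> : ch_map c @` (ch_dom c `&` \bigcup_(i in P) V i) =
    \bigcup_(i in P) (ch_map c @` (ch_dom c `&` V i)).
  apply/seteqP; split=> [_ [x [cx [i Pi Vx]] <-]|y [i Pi [x [cx Vx] <-]]].
    by exists i => //; exists x.
  by exists x => //; split => //; exists i.
by split=> k; apply: Ck_bigcup => i Pi; have [h1 h2] := hf i Pi c Ac.
Qed.

Lemma smooth_on_cst U (z : R[i]) : smooth_on U (fun=> z).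
Proof. by move=> c _; split=> k; exact: Ck_cst. Qed.

Lemma smooth_onD U f g : open U -> smooth_on U f -> smooth_on U g ->
  smooth_on U (fun x => f x + g x).
Proof.
move=> oU hf hg c Ac; have [f1 f2] := hf c Ac; have [g1 g2] := hg c Ac.
have oW := @chart_image_open c _ oU.
split=> k; [apply: Ck_ext oW _ (CkD oW (f1 k) (g1 k))
           |apply: Ck_ext oW _ (CkD oW (f2 k) (g2 k))] => y _.
  by rewrite raddfD.
by rewrite raddfD.
Qed.

Lemma smooth_onM U f g : open U -> smooth_on U f -> smooth_on U g ->
  smooth_on U (fun x => f x * g x).
Proof.
move=> oU hf hg c Ac; have [f1 f2] := hf c Ac; have [g1 g2] := hg c Ac.
have oW := @chart_image_open c _ oU.
split=> k.
- apply: Ck_ext oW _ (CkD oW (CkM oW (f1 k) (g1 k))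
    (CkN oW (CkM oW (f2 k) (g2 k)))) => y _.
  by case: (f _) => a b; case: (g _).
- apply: Ck_ext oW _ (CkD oW (CkM oW (f1 k) (g2 k)) (CkM oW (f2 k) (g1 k))) => y _.
  by case: (f _) => a b; case: (g _).
Qed.

Lemma smooth_on_conj U f : open U -> smooth_on U f ->
  smooth_on U (fun x => (f x)^*).
Proof.
move=> oU hf c Ac; have [f1 f2] := hf c Ac; have oW := @chart_image_open c _ oU.
split=> k; [apply: Ck_ext oW _ (f1 k) => y _
           |apply: Ck_ext oW _ (CkN oW (f2 k)) => y _]; by case: (f _).
Qed.

Lemma smooth_onV U f : open U -> (forall x, U x -> f x != 0) -> smooth_on U f ->
  smooth_on U (fun x => (f x)^-1).
Proof.
move=> oU f0 hf c Ac; have [f1 f2] := hf c Ac; have oW := @chart_image_open c _ oU.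
set W := (X in open X) in oW.
have hN k : Ck k W (fun y => (complex.Re (f (ch_inv c y)) ^+ 2 +
    complex.Im (f (ch_inv c y)) ^+ 2)^-1).
  apply: CkV => //; last by apply: CkD => //; apply: CkM.
  move=> _ [x [cx Ux] <-]; rewrite ch_mapK//; have := f0 _ Ux.
  case: (f x) => a b /=; apply: contra.
  by rewrite paddr_eq0 ?sqr_ge0// !sqrf_eq0 => /andP[/eqP -> /eqP ->].
split=> k; [apply: Ck_ext oW _ (CkM oW (f1 k) (hN k)) => y _
           |apply: Ck_ext oW _ (CkM oW (CkN oW (f2 k)) (hN k)) => y _];
  by case: (f _) => a b /=; rewrite ?mulNr.
Qed.

Lemma smooth_on_sum U (I : Type) (r : seq I) (P : pred I) (F : I -> M -> R[i]) :
  open U -> (forall i, P i -> smooth_on U (F i)) ->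
  smooth_on U (fun x => \sum_(i <- r | P i) F i x).
Proof.
move=> oU hF; elim: r => [|i r ih].
  by apply: smooth_on_ext (smooth_on_cst U 0) => // x _; rewrite big_nil.
case Pi : (P i).
  apply: smooth_on_ext (smooth_onD oU (hF _ Pi) ih) => // x _.
  by rewrite big_cons Pi.
by apply: smooth_on_ext ih => // x _; rewrite big_cons Pi.
Qed.

Lemma smooth_on_prod U (I : Type) (r : seq I) (P : pred I) (F : I -> M -> R[i]) :
  open U -> (forall i, P i -> smooth_on U (F i)) ->
  smooth_on U (fun x => \prod_(i <- r | P i) F i x).
Proof.
move=> oU hF; elim: r => [|i r ih].
  by apply: smooth_on_ext (smooth_on_cst U 1) => // x _; rewrite big_nil.
case Pi : (P i).
  apply: smooth_on_ext (smooth_onM oU (hF _ Pi) ih) => // x _.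
  by rewrite big_cons Pi.
by apply: smooth_on_ext ih => // x _; rewrite big_cons Pi.
Qed.

Lemma smooth_on_det U m (A : M -> 'M[R[i]]_m) : open U ->
  (forall i j, smooth_on U (fun x => A x i j)) -> smooth_on U (fun x => \det (A x)).
Proof.
move=> oU hA; apply: smooth_on_sum => // s _; apply: smooth_onM => //.
  exact: smooth_on_cst.
by apply: smooth_on_prod.
Qed.

Lemma smooth_on_invmx U m (A : M -> 'M[R[i]]_m) : open U ->
  (forall x, U x -> A x \in unitmx) ->
  (forall i j, smooth_on U (fun x => A x i j)) ->
  forall i j, smooth_on U (fun x => invmx (A x) i j).
Proof.
move=> oU uA hA i j.
have nz x : U x -> \det (A x) != 0 by move=> /uA; rewrite unitmxE unitfE.
have hd := smooth_onV oU nz (smooth_on_det oU hA).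
have hc : smooth_on U (fun x => \adj (A x) i j).
  have -> : (fun x => \adj (A x) i j) = (fun x => (-1) ^+ (j + i) *
      \det (row' j (col' i (A x)))).
    by apply/funext => x; rewrite mxE.
  apply: (smooth_onM oU); first exact: smooth_on_cst.
  apply: (smooth_on_det oU) => a b.
  by have -> : (fun x => row' j (col' i (A x)) a b) =
    (fun x => A x (lift j a) (lift i b)) by apply/funext => x; rewrite !mxE.
apply: (smooth_on_ext oU _ (smooth_onM oU hd hc)) => x Ux.
by rewrite /invmx (uA _ Ux) [RHS]mxE.
Qed.

End SmoothManifoldFunctions.

(** * Hermitian vector bundles *)

(* A local trivialization, over the open set [tr_dom], of a family of
   finite-dimensional complex vector spaces. *)
Record trivialization (R : realType) (n : nat) (M : smoothManifold R n)
    (E : M -> vectType R[i]) (k : nat) := Trivialization {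
  tr_dom : set M;
  tr_map : forall x, 'Hom(E x, 'rV[R[i]]_k);
  tr_dom_open : open tr_dom;
  tr_bij : forall x, tr_dom x -> bijective (tr_map x)
}.

Section Trivialization.
Variables (R : realType) (n : nat) (M : smoothManifold R n).
Variables (E : M -> vectType R[i]) (k : nat).
Implicit Types (t : trivialization E k) (x : M).

(* The [i]-th vector of the local frame given by the trivialization [t]. *)
Definition tr_frame t (i : 'I_k) x : E x := (tr_map t x)^-1%VF (delta_mx 0 i).

Definition tr_coord t (i : 'I_k) x (v : E x) : R[i] := tr_map t x v 0 i.

Lemma tr_mapK t x : tr_dom t x -> cancel (tr_map t x) (tr_map t x)^-1%VF.
Proof.
move=> /tr_bij[g fg gf]; apply: lker0_lfunK.
by apply/lker0P; exact: can_inj fg.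
Qed.

Lemma tr_mapVK t x : tr_dom t x -> cancel (tr_map t x)^-1%VF (tr_map t x).
Proof.
move=> tx v; have [g fg gf] := tr_bij tx.
by rewrite -(gf v) tr_mapK.
Qed.

Lemma tr_coordD t i x : {morph @tr_coord t i x : u v / u + v}.
Proof. by move=> u v; rewrite /tr_coord linearD mxE. Qed.

Lemma tr_coordZ t i x c v : tr_coord t i (c *: v : E x) = c * tr_coord t i v.
Proof. by rewrite /tr_coord linearZ mxE. Qed.

Lemma tr_coord0 t i x : tr_coord t i (0 : E x) = 0.
Proof. by rewrite /tr_coord linear0 mxE. Qed.

Lemma tr_coord_sum t i x (I : Type) (r : seq I) (F : I -> E x) :
  tr_coord t i (\sum_(j <- r) F j) = \sum_(j <- r) tr_coord t i (F j).
Proof. by rewrite /tr_coord linear_sum summxE. Qed.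

Lemma tr_frame_span t x (v : E x) : tr_dom t x ->
  v = \sum_i tr_coord t i v *: tr_frame t i x.
Proof.
move=> tx; rewrite -[LHS](tr_mapK tx) [in LHS](row_sum_delta (tr_map t x v)).
by rewrite linear_sum; apply: eq_bigr => i _; rewrite linearZ.
Qed.

Lemma tr_coord_frame t x i j : tr_dom t x ->
  tr_coord t i (tr_frame t j x) = (i == j)%:R.
Proof. by move=> tx; rewrite /tr_coord tr_mapVK// mxE eqxx. Qed.

End Trivialization.

(* Smooth complex vector bundles of rank k over M, presented by their fibers
   and by an atlas of local trivializations with smooth transition functions. *)
Record vectorBundle (R : realType) (n : nat) (M : smoothManifold R n)
    (k : nat) := VectorBundle {
  vb_fiber :> M -> vectType R[i];
  vb_atlas : set (trivialization vb_fiber k);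
  vb_cover : forall x, exists2 t, vb_atlas t & tr_dom t x;
  vb_compat : forall t t', vb_atlas t -> vb_atlas t' -> forall i j,
    smooth_on (tr_dom t `&` tr_dom t') (fun x => tr_coord t' i (tr_frame t j x))
}.

(* Hermitian fiber metrics, linear in the second argument. *)
Record hermitianMetric (R : realType) (n : nat) (M : smoothManifold R n)
    (k : nat) (E : vectorBundle M k) := HermitianMetric {
  hm :> forall x, E x -> E x -> R[i];
  hmD : forall x (u v w : E x), hm u (v + w) = hm u v + hm u w;
  hmZ : forall x c (u v : E x), hm u (c *: v) = c * hm u v;
  hm_herm : forall x (u v : E x), hm u v = (hm v u)^*;
  hm_pos : forall x (u : E x), u != 0 -> 0 < hm u u;
  hm_smooth : forall t, vb_atlas t -> forall i j,
    smooth_on (tr_dom t) (fun x => hm (tr_frame t i x) (tr_frame t j x))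
}.

Section HermitianAlgebra.
Variables (R : realType) (n : nat) (M : smoothManifold R n) (k : nat).
Variables (E : vectorBundle M k) (h : hermitianMetric E).
Implicit Types (x : M) (t : trivialization E k).

Lemma hmDl x (u v w : E x) : h x (u + v) w = h x u w + h x v w.
Proof. by rewrite (hm_herm h) hmD rmorphD /= -!(hm_herm h). Qed.

Lemma hmZl x c (u v : E x) : h x (c *: u) v = c^* * h x u v.
Proof. by rewrite (hm_herm h) hmZ rmorphM /= -(hm_herm h). Qed.

Lemma hm0 x (u : E x) : h x u 0 = 0.
Proof. by rewrite -(scale0r 0) hmZ mul0r. Qed.

Lemma hm0l x (u : E x) : h x 0 u = 0.
Proof. by rewrite (hm_herm h) hm0 rmorph0. Qed.

Lemma hm_sum x (u : E x) (I : Type) (r : seq I) (F : I -> E x) :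
  h x u (\sum_(j <- r) F j) = \sum_(j <- r) h x u (F j).
Proof. by apply: (big_morph _ (@hmD _ _ _ _ _ h x u) (hm0 u)). Qed.

Lemma hm_suml x (u : E x) (I : Type) (r : seq I) (F : I -> E x) :
  h x (\sum_(j <- r) F j) u = \sum_(j <- r) h x (F j) u.
Proof. by apply: (big_morph (h x ^~ u) (fun a b => hmDl a b u) (hm0l u)). Qed.

Lemma hm_eq0 x (u : E x) : h x u u = 0 -> u = 0.
Proof.
by move=> hu; apply/eqP; apply: contra_eqT hu => /(hm_pos h)/gt_eqF ->.
Qed.

Lemma hm_inj x (u v : E x) : (forall w, h x u w = h x v w) -> u = v.
Proof.
move=> huv; apply/eqP; rewrite -subr_eq0; apply/eqP/hm_eq0.
by rewrite hmDl -scaleN1r hmZl rmorphN rmorph1 mulN1r huv subrr.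
Qed.

Definition gram t x : 'M[R[i]]_k :=
  \matrix_(i, j) h x (tr_frame t i x) (tr_frame t j x).

Lemma gram_unit t x : tr_dom t x -> gram t x \in unitmx.
Proof.
move=> tx; rewrite -row_free_unit; apply: inj_row_free => v vG.
pose w := \sum_i (v 0 i)^* *: tr_frame t i x.
have w0 : w = 0.
  apply: hm_inj => u; rewrite hm0l (tr_frame_span u tx) hm_sum big1// => j _.
  rewrite hmZ hm_suml; suff -> : \sum_i h x ((v 0 i)^* *: tr_frame t i x)
    (tr_frame t j x) = (v *m gram t x) 0 j by rewrite vG mxE mulr0.
  by rewrite mxE; apply: eq_bigr => i _; rewrite hmZl conjCK mxE.
apply/rowP => i; rewrite mxE.
have := congr1 (@tr_coord _ _ _ _ _ t i x) w0; rewrite tr_coord0 tr_coord_sum.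
rewrite (bigD1 i)//= big1 ?addr0 => [|j ji].
  by rewrite tr_coordZ tr_coord_frame// eqxx mulr1 => /eqP; rewrite conjC_eq0 => /eqP.
by rewrite tr_coordZ tr_coord_frame// eq_sym (negPf ji) mulr0.
Qed.

Definition is_adjoint x (f g : 'End(E x)) : Prop :=
  forall v w, h x (g v) w = h x v (f w).

Lemma adjoint_exists x (f : 'End(E x)) : exists g, is_adjoint f g.
Proof.
have [t _ tx] := vb_cover E x.
pose a (v : E x) l := \sum_m h x v (f (tr_frame t m x)) * invmx (gram t x) m l.
pose g (v : E x) := \sum_l (a v l)^* *: tr_frame t l x.
have gl : linear g.
  move=> c u v; rewrite /g scaler_sumr -big_split /=; apply: eq_bigr => l _.
  rewrite scalerA -scalerDl; congr (_ *: _).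
  rewrite -[c in RHS]conjCK -rmorphM -rmorphD; congr (_^*).
  rewrite /a mulr_sumr -big_split /=; apply: eq_bigr => m _.
  by rewrite hmDl hmZl mulrDl mulrA.
pose gL : {linear E x -> E x} := HB.pack g (GRing.isLinear.Build _ _ _ _ g gl).
exists (linfun gL) => v w; rewrite lfunE /= (tr_frame_span w tx).
rewrite linear_sum !hm_sum; apply: eq_bigr => j _.
rewrite linearZ !hmZ; congr (_ * _); rewrite /g hm_suml.
transitivity (\sum_l a v l * gram t x l j).
  by apply: eq_bigr => l _; rewrite hmZl conjCK mxE.
pose r := \row_m h x v (f (tr_frame t m x)).
have := congr1 (fun A : 'rV_k => A 0 j) (mulmxKV (gram_unit tx) r).
rewrite [in RHS]mxE => <-; rewrite mxE; apply: eq_bigr => l _; congr (_ * _).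
by rewrite mxE; apply: eq_bigr => m _; rewrite mxE.
Qed.

(* The adjoint of an endomorphism of a fiber with respect to [h]. *)
Definition fiber_adjoint x (f : 'End(E x)) : 'End(E x) :=
  xget 0 [set g | is_adjoint f g].

Lemma fiber_adjointP x (f : 'End(E x)) v w :
  h x (fiber_adjoint f v) w = h x v (f w).
Proof.
rewrite /fiber_adjoint; case: xgetP => [g _ |]; first exact.
by have [g hg] := adjoint_exists f => /(_ g).
Qed.

Lemma fiber_adjoint_eq x (f g : 'End(E x)) :
  (forall v w, h x (g v) w = h x v (f w)) -> fiber_adjoint f = g.
Proof.
move=> hg; apply/lfunP => v; apply: hm_inj => w.
by rewrite fiber_adjointP hg.
Qed.

Lemma fiber_adjointPr x (f : 'End(E x)) v w :
  h x v (fiber_adjoint f w) = h x (f v) w.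
Proof. by rewrite (hm_herm h) fiber_adjointP -(hm_herm h). Qed.

(* The rank-one endomorphism w |-> u . h(v, w). *)
Definition fiber_rank_one_fun x (u v w : E x) : E x := h x v w *: u.

Fact fiber_rank_one_linear x (u v : E x) : linear (fiber_rank_one_fun u v).
Proof.
by move=> c a b; rewrite /fiber_rank_one_fun hmD hmZ scalerDl scalerA.
Qed.

HB.instance Definition _ x (u v : E x) := GRing.isLinear.Build R[i] (E x) (E x) _
  (fiber_rank_one_fun u v) (fiber_rank_one_linear u v).

Definition fiber_rank_one x (u v : E x) : 'End(E x) :=
  linfun (fiber_rank_one_fun u v).

Lemma fiber_rank_oneE x (u v w : E x) : fiber_rank_one u v w = h x v w *: u.
Proof. by rewrite lfunE. Qed.

Lemma hm_coord t x (u v : E x) : tr_dom t x ->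
  h x u v = \sum_j \sum_i (tr_coord t i u)^* * tr_coord t j v *
    h x (tr_frame t i x) (tr_frame t j x).
Proof.
move=> tx; rewrite {1}(tr_frame_span v tx) hm_sum; apply: eq_bigr => j _.
rewrite hmZ {1}(tr_frame_span u tx) hm_suml mulr_sumr; apply: eq_bigr => i _.
by rewrite hmZl mulrCA mulrA.
Qed.

End HermitianAlgebra.

(** * Spaces of smooth sections *)

(* Linear subspaces of the space of all sections of a family [F]. *)
Record subspace (C : numClosedFieldType) (T : Type) (F : T -> lmodType C) :=
  Subspace {
    ss_pred :> (forall x, F x) -> Prop;
    ss_0 : ss_pred (fun x => 0);
    ss_D : forall s t, ss_pred s -> ss_pred t -> ss_pred (fun x => s x + t x);
    ss_Z : forall (c : C) s, ss_pred s -> ss_pred (fun x => c *: s x)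
  }.

Record sections (C : numClosedFieldType) (T : Type) (F : T -> lmodType C)
    (P : subspace F) := Sections {
  sec_fun :> forall x, F x;
  sec_pred : P sec_fun
}.

HB.instance Definition _ (C : numClosedFieldType) (T : Type) (F : T -> lmodType C) (P : subspace F) :=
  gen_eqMixin (sections P).
HB.instance Definition _ (C : numClosedFieldType) (T : Type) (F : T -> lmodType C) (P : subspace F) :=
  gen_choiceMixin (sections P).

Section SectionSpace.
Variables (C : numClosedFieldType) (T : Type) (F : T -> lmodType C).
Variable P : subspace F.
Implicit Types s t : sections P.

Lemma sectionsP s t : (forall x, s x = t x) -> s = t.
Proof.
case: s t => [s Ps] [t Pt] /= st.
have e : s = t by apply: functional_extensionality_dep.
by move: Ps Pt; rewrite e => Ps Pt; congr Sections; exact: Prop_irrelevance.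
Qed.

Definition sec0 : sections P := Sections (ss_0 P).
Definition secD s t : sections P := Sections (ss_D (sec_pred s) (sec_pred t)).
Definition secZ (c : C) s : sections P := Sections (ss_Z c (sec_pred s)).
Definition secN s : sections P := secZ (-1) s.

Fact secDA : associative secD.
Proof. by move=> s t u; apply: sectionsP => x; exact: addrA. Qed.
Fact secDC : commutative secD.
Proof. by move=> s t; apply: sectionsP => x; exact: addrC. Qed.
Fact sec0D : left_id sec0 secD.
Proof. by move=> s; apply: sectionsP => x; exact: add0r. Qed.
Fact secND : left_inverse sec0 secN secD.
Proof. by move=> s; apply: sectionsP => x /=; rewrite scaleN1r addNr. Qed.

HB.instance Definition _ :=
  GRing.isZmodule.Build (sections P) secDA secDC sec0D secND.

Fact secZA a b s : secZ a (secZ b s) = secZ (a * b) s.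
Proof. by apply: sectionsP => x; exact: scalerA. Qed.
Fact sec1Z : left_id 1 secZ.
Proof. by move=> s; apply: sectionsP => x; exact: scale1r. Qed.
Fact secZDr : right_distributive secZ +%R.
Proof. by move=> a s t; apply: sectionsP => x; exact: scalerDr. Qed.
Fact secZDl s : {morph secZ^~ s : a b / a + b}.
Proof. by move=> a b; apply: sectionsP => x; exact: scalerDl. Qed.

HB.instance Definition _ := GRing.Zmodule_isLmodule.Build C (sections P)
  secZA sec1Z secZDr secZDl.

Lemma secDE s t x : (s + t) x = s x + t x. Proof. by []. Qed.
Lemma secZE (c : C) s x : (c *: s) x = c *: s x. Proof. by []. Qed.

End SectionSpace.

(** ** The *-algebra of smooth functions *)

Section SmoothFunctionAlgebra.
Variables (R : realType) (n : nat) (M : smoothManifold R n).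
Local Notation C := R[i].

Definition smooth_fun_subspace : subspace (fun _ : M => (C^o : lmodType C)).
Proof.
refine (@Subspace C M (fun=> C^o) (fun f => smooth_on setT (f : M -> C)) _ _ _).
- exact: smooth_on_cst.
- by move=> f g; apply: smooth_onD; exact: openT.
- by move=> c f; apply: smooth_onM; [exact: openT|exact: smooth_on_cst].
Defined.

Definition smooth_fun := sections smooth_fun_subspace.

Fact smooth_funM_subproof (f g : smooth_fun) :
  smooth_fun_subspace (fun x => (f x : C) * g x).
Proof. by apply: smooth_onM; [exact: openT|exact: (sec_pred f)|exact: (sec_pred g)]. Qed.

Fact smooth_fun_conj_subproof (f : smooth_fun) :
  smooth_fun_subspace (fun x => (f x : C)^*).
Proof. by apply: smooth_on_conj; [exact: openT|exact: (sec_pred f)]. Qed.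

Definition smooth_funM (f g : smooth_fun) : smooth_fun :=
  Sections (smooth_funM_subproof f g).
Definition smooth_fun_conj (f : smooth_fun) : smooth_fun :=
  Sections (smooth_fun_conj_subproof f).

Definition smooth_fun_algebra : starAlgebra C.
Proof.
refine (@StarAlgebra C smooth_fun smooth_funM smooth_fun_conj
  _ _ _ _ _ _ _ _ _).
- by move=> f g k; apply: sectionsP => x /=; rewrite mulrA.
- by move=> f g k; apply: sectionsP => x /=; exact: mulrDl.
- by move=> f g k; apply: sectionsP => x /=; exact: mulrDr.
- by move=> c f g; apply: sectionsP => x /=; exact: (esym (mulrA _ _ _)).
- by move=> c f g; apply: sectionsP => x /=; exact: mulrCA.
- by move=> f; apply: sectionsP => x /=; exact: conjCK.
- by move=> f g; apply: sectionsP => x /=; exact: rmorphD.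
- by move=> c f; apply: sectionsP => x /=; exact: rmorphM.
- by move=> f g; apply: sectionsP => x /=; rewrite rmorphM mulrC.
Defined.
End SmoothFunctionAlgebra.

(** ** Smooth sections of E and of End(E) *)

Section BundleSections.
Variables (R : realType) (n : nat) (M : smoothManifold R n) (k : nat).
Variables (E : vectorBundle M k).
Local Notation C := R[i].

Definition smooth_section (s : forall x, E x) : Prop :=
  forall t, vb_atlas t -> forall i,
    smooth_on (tr_dom t) (fun x => tr_coord t i (s x)).

(* A section of End(E) is smooth when its matrix entries in the local
   trivializations of E are smooth. *)
Definition smooth_endo (B : forall x, 'End(E x)) : Prop :=
  forall t, vb_atlas t -> forall i j,
    smooth_on (tr_dom t) (fun x => tr_coord t i (B x (tr_frame t j x))).

Definition section_subspace : subspace (fun x => E x : lmodType C).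
Proof.
refine (@Subspace C M (fun x => E x) smooth_section _ _ _).
- move=> t At i; have oU := @tr_dom_open _ _ _ _ _ t.
  apply: (smooth_on_ext oU _ (smooth_on_cst _ 0)) => x _; rewrite tr_coord0 //.
- move=> s s' hs hs' t At i; have oU := @tr_dom_open _ _ _ _ _ t.
  apply: (smooth_on_ext oU _ (smooth_onD oU (hs t At i) (hs' t At i))) => x _.
  by rewrite tr_coordD.
- move=> c s hs t At i; have oU := @tr_dom_open _ _ _ _ _ t.
  apply: (smooth_on_ext oU _ (smooth_onM oU (smooth_on_cst _ c) (hs t At i))) => x _.
  by rewrite tr_coordZ.
Defined.

Definition endo_subspace : subspace (fun x => 'End(E x) : lmodType C).
Proof.
refine (@Subspace C M (fun x => 'End(E x)) smooth_endo _ _ _).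
- move=> t At i j; have oU := @tr_dom_open _ _ _ _ _ t.
  apply: (smooth_on_ext oU _ (smooth_on_cst _ 0)) => x _.
  by rewrite zero_lfunE tr_coord0.
- move=> s s' hs hs' t At i j; have oU := @tr_dom_open _ _ _ _ _ t.
  apply: (smooth_on_ext oU _ (smooth_onD oU (hs t At i j) (hs' t At i j))) => x _.
  by rewrite add_lfunE tr_coordD.
- move=> c s hs t At i j; have oU := @tr_dom_open _ _ _ _ _ t.
  apply: (smooth_on_ext oU _ (smooth_onM oU (smooth_on_cst _ c) (hs t At i j))) => x _.
  by rewrite scale_lfunE tr_coordZ.
Defined.

Definition Gamma := sections section_subspace.
Definition GammaEnd := sections endo_subspace.

Lemma endo_apply_smooth (B : GammaEnd) (s : Gamma) :
  smooth_section (fun x => B x (s x)).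
Proof.
move=> t At i; have oU := @tr_dom_open _ _ _ _ _ t.
apply: (smooth_on_ext oU (f := fun x => \sum_j tr_coord t j (s x) *
    tr_coord t i (B x (tr_frame t j x)))) => [x tx|].
  rewrite [in RHS](tr_frame_span (s x) tx) linear_sum tr_coord_sum.
  by apply: eq_bigr => j _; rewrite linearZ tr_coordZ.
apply: smooth_on_sum => // j _; apply: (smooth_onM oU).
  exact: (sec_pred s t At j).
exact: (sec_pred B t At i j).
Qed.

Lemma endo_comp_smooth (A B : GammaEnd) :
  smooth_endo (fun x => (A x \o B x)%VF).
Proof.
move=> t At i j; have oU := @tr_dom_open _ _ _ _ _ t.
apply: (smooth_on_ext oU (f := fun x =>
    \sum_l tr_coord t l (B x (tr_frame t j x)) *
      tr_coord t i (A x (tr_frame t l x)))) => [x tx|].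
  rewrite comp_lfunE [in RHS](tr_frame_span (B x _) tx) linear_sum tr_coord_sum.
  by apply: eq_bigr => l _; rewrite linearZ tr_coordZ.
apply: smooth_on_sum => // l _; apply: (smooth_onM oU).
  exact: (sec_pred B t At l j).
exact: (sec_pred A t At i l).
Qed.

Lemma fun_scale_smooth (s : Gamma) (f : smooth_fun M) :
  smooth_section (fun x => (f x : C) *: s x).
Proof.
move=> t At i; have oU := @tr_dom_open _ _ _ _ _ t.
have hf : smooth_on (tr_dom t) (fun x => f x : C).
  by apply: (smooth_on_sub (U := setT)) => //; exact: (sec_pred f).
apply: (smooth_on_ext oU _ (smooth_onM oU hf (sec_pred s t At i))) => x _.
by rewrite tr_coordZ.
Qed.

Variable h : hermitianMetric E.

Lemma gram_inv_smooth t : vb_atlas t -> forall i j,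
  smooth_on (tr_dom t) (fun x => invmx (gram h t x) i j).
Proof.
move=> At; have oU := @tr_dom_open _ _ _ _ _ t.
apply: (smooth_on_invmx oU) => [x tx|i j]; first exact: gram_unit.
by apply: (smooth_on_ext oU _ (hm_smooth h At i j)) => x _; rewrite mxE.
Qed.

Lemma endo_adjoint_smooth (B : GammaEnd) :
  smooth_endo (fun x => fiber_adjoint h (B x)).
Proof.
move=> t At i j; have oU := @tr_dom_open _ _ _ _ _ t.
apply: (smooth_on_ext oU (f := fun x => (\sum_m
    (\sum_p tr_coord t p (B x (tr_frame t m x)) *
       h x (tr_frame t j x) (tr_frame t p x)) *
    invmx (gram h t x) m i)^*)) => [x tx|]; last first.
  apply: (smooth_on_conj oU); apply: smooth_on_sum => // m _.
  apply: (smooth_onM oU); last exact: gram_inv_smooth.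
  apply: smooth_on_sum => // p _; apply: (smooth_onM oU).
    exact: (sec_pred B t At p m).
  exact: hm_smooth.
set w := fiber_adjoint h (B x) (tr_frame t j x).
pose a : 'rV[C]_k := \row_l (tr_coord t l w)^*.
pose r : 'rV[C]_k := \row_m h x (tr_frame t j x) (B x (tr_frame t m x)).
have aG : a *m gram h t x = r.
  apply/rowP => m; rewrite !mxE -fiber_adjointP -/w.
  rewrite [in RHS](tr_frame_span w tx) hm_suml.
  by apply: eq_bigr => l _; rewrite hmZl !mxE.
have /rowP/(_ i) : a = r *m invmx (gram h t x).
  by rewrite -aG mulmxK// gram_unit.
rewrite !mxE => /(congr1 Num.conj); rewrite conjCK => ->; congr (_^*).
apply: eq_bigr => m _; congr (_ * _); rewrite mxE.
rewrite [in RHS](tr_frame_span (B x _) tx) hm_sum.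
by apply: eq_bigr => p _; rewrite hmZ.
Qed.

Lemma metric_smooth (u v : Gamma) :
  smooth_fun_subspace M (fun x => h x (u x) (v x)).
Proof.
suff H (t : trivialization E k) : vb_atlas t -> smooth_on (tr_dom t) (fun x => h x (u x) (v x)).
  have -> : smooth_fun_subspace M (fun x => h x (u x) (v x)) =
      smooth_on (\bigcup_(t in @vb_atlas _ _ _ _ E) tr_dom t) (fun x => h x (u x) (v x)).
    congr smooth_on; apply/esym; rewrite -subTset => x _.
    by have [t At tx] := vb_cover E x; exists t.
  exact: smooth_on_cover.
move=> At; have oU := @tr_dom_open _ _ _ _ _ t.
apply: (smooth_on_ext oU (f := fun x => \sum_j \sum_i
    (tr_coord t i (u x))^* * tr_coord t j (v x) *
    h x (tr_frame t i x) (tr_frame t j x))) => [x tx|].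
  by rewrite -hm_coord.
apply: smooth_on_sum => // j _; apply: smooth_on_sum => // i _.
apply: (smooth_onM oU); last exact: hm_smooth.
apply: (smooth_onM oU); last exact: (sec_pred v t At j).
by apply: (smooth_on_conj oU); exact: (sec_pred u t At i).
Qed.

Lemma rank_one_smooth (u v : Gamma) :
  smooth_endo (fun x => fiber_rank_one h (u x) (v x)).
Proof.
move=> t At i j; have oU := @tr_dom_open _ _ _ _ _ t.
apply: (smooth_on_ext oU (f := fun x => (\sum_l (tr_coord t l (v x))^* *
    h x (tr_frame t l x) (tr_frame t j x)) * tr_coord t i (u x))) => [x tx|].
  rewrite fiber_rank_oneE tr_coordZ; congr (_ * _).
  rewrite [in RHS](tr_frame_span (v x) tx) hm_suml.
  by apply: eq_bigr => l _; rewrite hmZl.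
apply: (smooth_onM oU); last exact: (sec_pred u t At i).
apply: smooth_on_sum => // l _; apply: (smooth_onM oU); last exact: hm_smooth.
by apply: (smooth_on_conj oU); exact: (sec_pred v t At l).
Qed.

Definition endo_comp (A B : GammaEnd) : GammaEnd :=
  @Sections _ _ _ endo_subspace _ (endo_comp_smooth A B).
Definition endo_adjoint (B : GammaEnd) : GammaEnd :=
  @Sections _ _ _ endo_subspace _ (endo_adjoint_smooth B).
Definition endo_apply (B : GammaEnd) (s : Gamma) : Gamma :=
  @Sections _ _ _ section_subspace _ (endo_apply_smooth B s).
Definition fun_scale (s : Gamma) (f : smooth_fun M) : Gamma :=
  @Sections _ _ _ section_subspace _ (fun_scale_smooth s f).

Definition endo_algebra : starAlgebra C.
Proof.
refine (@StarAlgebra C GammaEnd endo_comp endo_adjoint _ _ _ _ _ _ _ _ _).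
- by move=> A B D; apply: sectionsP => x /=; exact: comp_lfunA.
- by move=> A B D; apply: sectionsP => x /=; exact: comp_lfunDl.
- by move=> A B D; apply: sectionsP => x /=; exact: comp_lfunDr.
- by move=> c A B; apply: sectionsP => x /=; rewrite comp_lfunZl.
- by move=> c A B; apply: sectionsP => x /=; rewrite comp_lfunZr.
- move=> A; apply: sectionsP => x /=; apply: fiber_adjoint_eq => v w.
  by rewrite fiber_adjointPr.
- move=> A B; apply: sectionsP => x /=; apply: fiber_adjoint_eq => v w.
  by rewrite !add_lfunE hmDl hmD !fiber_adjointP.
- move=> c A; apply: sectionsP => x /=; apply: fiber_adjoint_eq => v w.
  by rewrite !scale_lfunE hmZl hmZ fiber_adjointP conjCK.
- move=> A B; apply: sectionsP => x /=; apply: fiber_adjoint_eq => v w.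
  by rewrite !comp_lfunE !fiber_adjointP.
Defined.

Fact endo_one_smooth : smooth_endo (fun x => \1%VF).
Proof.
move=> t At i j; have oU := @tr_dom_open _ _ _ _ _ t.
apply: (smooth_on_ext oU _ (smooth_on_cst _ (i == j)%:R)) => x tx.
by rewrite id_lfunE tr_coord_frame.
Qed.

Let endo_one : GammaEnd := @Sections _ _ _ endo_subspace _ endo_one_smooth.
Let smooth_fun_one : smooth_fun M :=
  @Sections _ _ _ (smooth_fun_subspace M) _ (@smooth_on_cst _ _ M setT 1).

Definition section_bimodule : bimodule endo_algebra (smooth_fun_algebra M).
Proof.
refine (@Bimodule C endo_algebra (smooth_fun_algebra M) Gamma
  endo_apply fun_scale _ _ _ _ _ _ _ _ _ _ _ _ _).
- by move=> B s s'; apply: sectionsP => x; exact: linearD.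
- by move=> A B s; apply: sectionsP => x; exact: add_lfunE.
- by move=> z B s; apply: sectionsP => x; exact: linearZ.
- by move=> z B s; apply: sectionsP => x; exact: scale_lfunE.
- by move=> A B s; apply: sectionsP => x; exact: comp_lfunE.
- move=> e he s; apply: sectionsP => x /=.
  have [/(congr1 (fun B : GammaEnd => B x (s x))) /= + _] := he endo_one.
  by rewrite comp_lfunE !id_lfunE.
- by move=> s s' f; apply: sectionsP => x; exact: scalerDr.
- by move=> s f g; apply: sectionsP => x; exact: scalerDl.
- by move=> z s f; apply: sectionsP => x /=; rewrite !scalerA mulrC.
- by move=> z s f; apply: sectionsP => x /=; rewrite scalerA.
- by move=> s f g; apply: sectionsP => x /=; rewrite scalerA mulrC.
- move=> e he s; apply: sectionsP => x /=.
  have [/(congr1 (fun f : smooth_fun M => f x : C)) /= + _] := he smooth_fun_one.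
  by rewrite mulr1 => ->; rewrite scale1r.
- by move=> B s f; apply: sectionsP => x; exact/esym/linearZ.
Defined.

(* The C^oo(M)-valued inner product (u, v) |-> h(u, v). *)
Definition section_metric (u v : section_bimodule) : smooth_fun_algebra M :=
  @Sections _ _ _ (smooth_fun_subspace M) _ (metric_smooth u v).

(* The End(E)-valued inner product (u, v) |-> Theta_{u,v}. *)
Definition section_rank_one (u v : section_bimodule) : endo_algebra :=
  @Sections _ _ _ endo_subspace _ (rank_one_smooth u v).

End BundleSections.

(* Main.v *)
(* The point is that, although M need not be compact, finitely many smooth
   sections s_i span every fiber of E.  Take a locally finite countable family
   of bump functions phi_j > 0 whose supports carry local frames e_j, and put
   s_{l,i} = sum_j c_{j,l} phi_j e_{j,i} for l < N with real coefficients c_{j,l}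
   chosen one j at a time.  At a point x whose last active index is j, these are
   a frame for a given l unless -c_{j,l} is an eigenvalue of a k x k matrix
   depending smoothly on x; the vectors c_j that fail for every l and some x
   form a meager set as soon as N > n k, by counting boxes.

   The operator S = sum_i Theta_{s_i,s_i} is then invertible with smooth inverse,
   and b = sum_i Theta_{b S^-1 s_i, s_i} gives fullness over End(E).  Since k >= 1,
   dividing by the square root of sum_i h(s_i,s_i) > 0 gives sections u_i with
   sum_i h(u_i,u_i) = 1; hence fullness over C^oo(M), and the identity
   Theta_{x,y} = sum_i Theta_{u_i,x}^* Theta_{u_i,y} yields positivity and
   property Q.  For C^oo(M), a pointwise positive definite matrix of smooth
   functions has a smooth Cholesky factorization, which is applied to
   (h(x_i,x_j) + e delta_ij) before letting e tend to 0. *)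
Require Import Defs.
From HB Require Import structures.
From mathcomp Require Import all_boot all_order all_algebra.
From mathcomp Require Import all_classical all_reals all_analysis complex.
From mathcomp Require Import ring lra zify.

Set Implicit Arguments.
Unset Strict Implicit.
Unset Printing Implicit Defensive.

Import Order.TTheory GRing.Theory Num.Theory numFieldNormedType.Exports.

Local Open Scope classical_set_scope.
Local Open Scope ring_scope.

(** * Calculus *)

Section SmoothComposition.
Variables (R : realType) (n : nat).
Implicit Types (W : set 'rV[R]_n) (f : 'rV[R]_n -> R).

(** The directional difference quotient along [v] is a one-variable quotient along the line
    [t *: v + x]. One-variable calculus thus applies to directional derivatives. *)
Lemma derive_quotient_line f (x v : 'rV[R]_n) s :
  (fun r : R => r^-1 *: (((fun t : R => f (t *: v + x)) \o shift s) (r *: 1) -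
     f (s *: v + x))) =
  (fun r : R => r^-1 *: ((f \o shift (s *: v + x)) (r *: v) - f (s *: v + x))).
Proof.
apply/funext => r /=.
by rewrite [r *: 1]/GRing.scale /= mulr1 scalerDl addrA.
Qed.

Lemma is_derive_line f (x v : 'rV[R]_n) (s : R) :
  derivable f (s *: v + x) v ->
  is_derive s 1 (fun t : R => f (t *: v + x)) ('D_v f (s *: v + x)).
Proof.
rewrite /derivable -derive_quotient_line => df.
by split=> //; rewrite /derive derive_quotient_line.
Qed.

(** Chain rule along [v], obtained by restricting [f] to the line through [x] and composing there
    with [g]. *)
Lemma is_derive_compl (g : R -> R) g' f (x v : 'rV[R]_n) :
  is_derive (f x) 1 g g' -> derivable f x v ->
  derivable (g \o f) x v /\ 'D_v (g \o f) x = g' * 'D_v f x.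
Proof.
have x0 : x = (0 : R) *: v + x by rewrite scale0r add0r.
rewrite x0 => dg /is_derive_line dl.
have [d1 d2] := is_derive1_comp dg dl; split.
  by move: d1; rewrite /derivable -(derive_quotient_line (g \o f)).
by rewrite -d2 /derive (derive_quotient_line (g \o f)).
Qed.

(** Induction on [k]: the partial derivatives are [(2 * sqrt f)^-1] times those of [f], so order
    [k.+1] only calls on [sqrt f] at order [k]. *)
Lemma Ck_sqrt k W f : open W -> (forall x, W x -> 0 < f x) -> Ck k W f ->
  Ck k W (fun x => Num.sqrt (f x)).
Proof.
move=> oW f0; elim: k => [|k ih] hf; split => //.
1,2: by move=> x Wx; apply: (@continuous_comp _ _ _ f Num.sqrt);
  [exact: Ck_cont hf Wx|exact: sqrt_continuous].
move=> i; have [_ /(_ i)[df Cf]] := hf.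
have H x : W x -> _ := fun Wx => is_derive_compl (is_derive1_sqrt (f0 x Wx)) (df x Wx).
split; first by move=> x /H[].
have h2 := CkM oW (Ck_cst k W 2) (ih (Ck_prev hf)).
have h2n x : W x -> 2 * Num.sqrt (f x) != 0.
  by move=> Wx; rewrite mulf_neq0// ?pnatr_eq0// sqrtr_eq0 -ltNge f0.
by apply: Ck_ext oW _ (CkM oW (CkV oW h2n h2) Cf) => x /H[_ ->].
Qed.

End SmoothComposition.

(** * The flat function exp(-1/t) and its derivatives *)

Section FlatFunction.
Variable R : realType.

(** The classical flat function is [flat 0]; the factor [t^-1 ^+ m] makes the linear span of the
    family stable under differentiation. *)
Definition flat (m : nat) (t : R) : R :=
  if 0 < t then t^-1 ^+ m * expR (- t^-1) else 0.

Lemma flat_le0 m t : t <= 0 -> flat m t = 0.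
Proof. by rewrite /flat leNgt => /negbTE ->. Qed.

Lemma flat_gt0 m t : (0 < flat m t) = (0 < t).
Proof.
rewrite /flat; case: ifPn => [t0|]; last by rewrite ltxx.
by rewrite mulr_gt0 ?expR_gt0// exprn_gt0// invr_gt0.
Qed.

Lemma flat_ge0 m t : 0 <= flat m t.
Proof.
by have [t0|t0] := ltP 0 t; [rewrite ltW// flat_gt0|rewrite flat_le0].
Qed.

Lemma flat_div m t : t^-1 * flat m t = flat m.+1 t.
Proof. by rewrite /flat; case: ifP => // _; rewrite ?mulr0// exprS mulrA. Qed.

(* From [1 + u / m <= exp (u / m)] with [u = 1 / t]. *)
Lemma flat_bound m t : 0 < t -> flat m t <= m.+1%:R ^+ m.+1 * t.
Proof.
move=> t0; rewrite /flat t0; set u := t^-1.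
have u0 : 0 < u by rewrite invr_gt0.
have tE : t = u^-1 by rewrite invrK.
have m0 : 0 < m.+1%:R :> R by [].
have h : (u / m.+1%:R) ^+ m.+1 <= expR u.
  have -> : expR u = expR (u / m.+1%:R) ^+ m.+1.
    by rewrite -expRM_natl mulrC divfK// gt_eqF.
  rewrite lerXn2r ?nnegrE ?expR_ge0//; first by rewrite divr_ge0// ltW.
  by rewrite (le_trans _ (expR_ge1Dx _))// lerDr.
rewrite expRN ler_pdivrMr ?expR_gt0// tE.
apply: le_trans (ler_wpM2l _ h); last first.
  by rewrite divr_ge0// ?exprn_ge0// ltW.
rewrite expr_div_n.
suff -> : m.+1%:R ^+ m.+1 * u^-1 * (u ^+ m.+1 / m.+1%:R ^+ m.+1) = u ^+ m :> R by [].
have -> : m.+1%:R ^+ m.+1 * u^-1 * (u ^+ m.+1 / m.+1%:R ^+ m.+1) =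
  u ^+ m * (u / u) * (m.+1%:R ^+ m.+1 / m.+1%:R ^+ m.+1) :> R.
  by rewrite (exprS u); ring.
by rewrite !divff ?mulr1// ?expf_neq0// gt_eqF.
Qed.

Lemma is_derive_flat m (t : R) :
  is_derive t 1 (flat m) (flat m.+2 t - m%:R * flat m.+1 t).
Proof.
have [t0|t0|t0] := ltgtP t 0.
- rewrite !flat_le0 ?ltW// mulr0 subr0.
  apply: near_eq_is_derive (is_derive_cst 0 t 1); near=> s.
  by rewrite flat_le0// ltW//; near: s; exact: lt_nbhsl.
- have t1 : t != 0 by rewrite gt_eqF.
  have h1 : is_derive t 1 (fun s : R => s^-1) (- t ^- 2).
    by have := is_deriveV t1 (is_derive_id t 1); rewrite /GRing.scale /= mulr1.
  have h2 : is_derive t 1 (fun s : R => s^-1 ^+ m * expR (- s^-1))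
     (flat m.+2 t - m%:R * flat m.+1 t).
    have hX : is_derive t^-1 1 (fun u : R => u ^+ m) (m%:R * t^-1 ^+ m.-1).
      have [dX eX] := is_deriveX m (is_derive_id t^-1 1).
      have -> : (fun u : R => u ^+ m) = (fun u => u) ^+ m.
        by apply/funext => u; rewrite exprfctE.
      by split; [exact: dX|rewrite [LHS]eX /GRing.scale /= mulr1].
    have hE : is_derive t^-1 1 (fun u : R => expR (- u)) (- expR (- t^-1)).
      have hN := is_deriveN (is_derive_id t^-1 1).
      have [dE eE] := is_derive1_comp (is_derive_expR (- t^-1)) hN.
      by split; [exact: dE|rewrite [LHS]eE mulrN1].
    have [dP eP] := is_derive1_comp (is_deriveM hX hE) h1.
    split; [exact: dP|rewrite [LHS]eP].
    rewrite /flat t0 /GRing.scale /= !exprS; move: t1 {dP eP}.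
    by clear -t0; case: m => [|p]; move=> t1; rewrite ?exprS /=; field.
  apply: near_eq_is_derive h2; near=> s.
  have s0 : 0 < s by near: s; exact: lt_nbhsr.
  by rewrite /flat s0.
- rewrite t0 2?flat_le0// mulr0 subr0.
  (* At 0 the difference quotient of [flat m] is [flat m.+1], which [flat_bound] squeezes to 0. *)
  have h0 : (fun r : R => r^-1 *: ((flat m \o shift 0) (r *: 1) - flat m 0)) @
      0^' --> (0 : R).
    have -> : (fun r : R => r^-1 *: ((flat m \o shift 0) (r *: 1) - flat m 0)) =
        flat m.+1.
      apply/funext => r; rewrite /GRing.scale /= (@flat_le0 _ 0)// subr0 addr0.
      by rewrite mulr1 flat_div.
    apply: cvg_within_filter.
    apply: (@squeeze_cvgr _ _ _ _ (fun=> 0) (fun s => m.+2%:R ^+ m.+2 * `|s|)).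
    - near=> s; rewrite flat_ge0 /=; have [s0|s0] := ltP 0 s.
        by rewrite (gtr0_norm s0) flat_bound.
      by rewrite flat_le0// mulr_ge0.
    - exact: cvg_cst.
    - rewrite -[X in _ --> X](mulr0 (m.+2%:R ^+ m.+2)).
      apply: cvgM; first exact: cvg_cst.
      have := cvg_norm (@cvg_id _ (nbhs (0 : R))); rewrite normr0; exact.
  have dz : derivable (flat m) 0 1 by apply/cvg_ex; exists 0; exact: h0.
  split => //.
  exact: (cvg_lim _ h0).
Unshelve. all: by end_near. Qed.
End FlatFunction.

(** The induction on [k] is uniform in [m], because differentiating [flat m] raises the index to
    [m.+1] and [m.+2]. *)
Lemma Ck_flat (R : realType) n k m (W : set 'rV[R]_n) f : open W -> Ck k W f ->
  Ck k W (fun x => flat m (f x)).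
Proof.
move=> oW; elim: k m => [|k ih] m hf; split => //.
1,2: move=> x Wx; apply: (@continuous_comp _ _ _ f (flat m));
  [exact: Ck_cont hf Wx|apply: differentiable_continuous; apply/derivable1_diffP;
   by case: (is_derive_flat m (f x))].
move=> i; have [_ /(_ i)[df Cf]] := hf.
have H x : W x -> _ := fun Wx => is_derive_compl (is_derive_flat m (f x)) (df x Wx).
split; first by move=> x /H[].
have C1 := CkM oW (Ck_cst k W m%:R) (ih m.+1 (Ck_prev hf)).
have C2 := CkD oW (ih m.+2 (Ck_prev hf)) (CkN oW C1).
by apply: Ck_ext oW _ (CkM oW C2 Cf) => x /H[_ ->].
Qed.

(** * C^1 functions are locally Lipschitz *)

Section LocalLipschitz.
Variables (R : realType) (n : nat).
Implicit Types (W : set 'rV[R]_n) (f : 'rV[R]_n -> R).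

(** For [m] from 0 to [n], these points lead from [x] to [y] by changing one coordinate at a
    time. *)
Definition mixed_row (x y : 'rV[R]_n) (m : nat) : 'rV[R]_n :=
  \row_i (if (i < m)%N then y 0 i else x 0 i).

Lemma mixed_row0 x y : mixed_row x y 0 = x.
Proof. by apply/rowP => i; rewrite mxE. Qed.

Lemma mixed_row_max x y : mixed_row x y n = y.
Proof. by apply/rowP => i; rewrite mxE ltn_ord. Qed.

Lemma mixed_rowS x y (i : 'I_n) :
  mixed_row x y i.+1 = (y 0 i - x 0 i) *: delta_mx 0 i + mixed_row x y i.
Proof.
apply/rowP => j; rewrite !mxE ltnS leq_eqVlt -[j == i in RHS]val_eqE eqxx /=.
case: (ltngtP j i) => [_|_|/val_inj ->] /=; rewrite ?mulr0 ?add0r//.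
by rewrite mulr1 subrK.
Qed.

Lemma ball_rowP (x y : 'rV[R]_n) r : 0 < r ->
  ball x r y <-> forall i, `|x 0 i - y 0 i| < r.
Proof.
move=> r0; split=> [[_ h] i|h]; first exact: h.
by split=> // i j; rewrite ord1; exact: h.
Qed.

(** The mean value theorem is applied on each segment of the path of [mixed_row], and the increments
    telescope. *)
Lemma Ck1_lipschitz_near W f x0 : open W -> W x0 -> Ck 1 W f ->
  exists r L, [/\ 0 < r, 0 <= L, ball x0 r `<=` W &
    forall x y, ball x0 r x -> ball x0 r y ->
      `|f x - f y| <= L * \sum_i `|x 0 i - y 0 i|].
Proof.
move=> oW Wx0 [_ Hf].
pose g i x := 'D_(delta_mx 0 i) f x.
(* The [+ 1] leaves room for continuity to keep every partial derivative below [L] near [x0]. *)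
pose L := \sum_i (`|g i x0| + 1).
have L0 : 0 <= L by apply: sumr_ge0 => i _; rewrite addr_ge0.
have : \forall x \near x0, W x /\ forall i, `|g i x| <= L.
  apply: filterI; first exact: open_nbhs_nbhs.
  apply: (@filter_forall _ _ (fun i x => `|g i x| <= L) (nbhs x0) _) => i; have [_ [gc _]] := Hf i.
  have /cvgrPdist_lt/(_ _ ltr01) := gc _ Wx0; apply: filterS => x gx.
  rewrite /L (bigD1 i)//= -[leLHS]addr0; apply: lerD.
    rewrite -[x in g i x]/x -lerBlDl (le_trans (lerB_dist _ _))//.
    by rewrite distrC ltW.
  by apply: sumr_ge0 => j _; rewrite addr_ge0.
move=> /nbhs_ballP[r r0 hr]; exists r, L; split => //; first by move=> x /hr[].
move=> x y xr yr.
pose z := mixed_row x y.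
have step (i : 'I_n) : `|f (z i.+1) - f (z i)| <= L * `|x 0 i - y 0 i|.
  set d := y 0 i - x 0 i.
  pose p (s : R) := (s * d) *: delta_mx 0 i + z i.
  (* Coordinate [i] of [p s] is a convex combination of those of [x] and [y], and each other
     coordinate is taken from [x] or [y]; hence [p s] stays in the sup-norm ball. *)
  have pW (s : R) : 0 <= s <= 1 -> ball x0 r (p s).
    move=> /andP[s0 s1]; apply/ball_rowP => // j.
    move: xr yr => /(ball_rowP _ _ r0)/(_ j) xr /(ball_rowP _ _ r0)/(_ j) yr.
    rewrite !mxE eqxx /=; case: (eqVneq j i) => [ji|ji]; last first.
      by rewrite mulr0 add0r; case: ifP.
    rewrite ji ltnn mulr1 /d; move: xr yr; rewrite ji !ltr_norml => /andP[x1 x2] /andP[y1 y2].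
    have conv A B : 0 < A -> 0 < B -> 0 < (1 - s) * A + s * B.
      move=> A0 B0; have [s2|s2] := ltP s 1.
        by apply: ltr_wpDr; [rewrite mulr_ge0// ltW|rewrite mulr_gt0// subr_gt0].
      apply: ltr_wpDl; first by rewrite mulr_ge0 ?subr_ge0// ltW.
      by rewrite mulr_gt0// (lt_le_trans _ s2).
    have h1 : 0 < (1 - s) * (x0 0 i - x 0 i + r) + s * (x0 0 i - y 0 i + r).
      apply: conv; lra.
    have h2 : 0 < (1 - s) * (r - (x0 0 i - x 0 i)) + s * (r - (x0 0 i - y 0 i)).
      apply: conv; lra.
    by clear -h1 h2; apply/andP; split; nra.
  have dp (s : R) : 0 <= s <= 1 -> is_derive s 1 (fun s => f (p s)) (g i (p s) * d).
    move=> /pW/hr[Wp _]; have [df _] := Hf i.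
    have dl := is_derive_line (df _ Wp).
    have dm : is_derive s 1 (fun s : R => s * d) d.
      have := is_deriveM (is_derive_id s 1) (is_derive_cst d s 1).
      by move=> [? e]; split=> //; rewrite [LHS]e scaler0 add0r /GRing.scale /= mulr1.
    have [q1 q2] := @is_derive1_comp _ _ (fun s : R => s * d) s _ _ dl dm.
    by split; [exact: q1|exact: q2].
  have [c c01] : exists2 c, c \in `[0, 1] & f (p 1) - f (p 0) = g i (p c) * d * (1 - 0).
    apply: (@MVT_segment _ (fun s => f (p s)) (fun s => g i (p s) * d)) => //.
      by move=> s; rewrite in_itv /= => /andP[? ?]; apply: dp; rewrite !ltW.
    apply: derivable_within_continuous => s; rewrite in_itv /= => /dp.
    by case.
  rewrite subr0 mulr1 /p mul1r mul0r scale0r add0r -mixed_rowS => ->.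
  rewrite normrM distrC; apply: ler_wpM2r => //.
  by have [_] := hr _ (pW c c01); exact.
rewrite -[in f x](mixed_row0 x y) -[in f y](mixed_row_max x y) distrC.
rewrite -(telescope_sumr (fun m => f (z m)) (leq0n n)) big_mkord mulr_sumr.
by apply: le_trans (ler_norm_sum _ _ _) _; exact: ler_sum.
Qed.
End LocalLipschitz.

(** * Generic coefficients *)

Section GenericValues.
Variables (R : realType) (n k N : nat).

(** Index of the cell containing [x] when the sup-norm ball of center [x0] and radius [r] is cut
    into [P.+1] slices of width [2 * r / P.+1%:R] in each coordinate. *)
Definition row_cell (P : nat) (x0 : 'rV[R]_n) (r : R) (x : 'rV[R]_n) :
    {ffun 'I_n -> 'I_P.+1} :=
  [ffun i => inord (Num.truncn ((x 0 i - x0 0 i + r) * (P.+1%:R / (2 * r))))].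

Lemma row_cell_dist P x0 r (x y : 'rV[R]_n) : 0 < r ->
  ball x0 r x -> ball x0 r y -> row_cell P x0 r x = row_cell P x0 r y ->
  \sum_i `|x 0 i - y 0 i| <= n%:R * (2 * r / P.+1%:R).
Proof.
move=> r0 /(ball_rowP _ _ r0) xr /(ball_rowP _ _ r0) yr exy.
have P0 : 0 < P.+1%:R :> R by [].
pose a := P.+1%:R / (2 * r).
have a0 : 0 < a by rewrite divr_gt0// mulr_gt0.
suff H i : `|x 0 i - y 0 i| <= 2 * r / P.+1%:R.
  apply: le_trans (ler_sum _ (fun i _ => H i)) _.
  by rewrite sumr_const card_ord [leRHS]mulr_natl.
have aux (z : 'rV[R]_n) : `|x0 0 i - z 0 i| < r ->
    let v := (z 0 i - x0 0 i + r) * a in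
    [/\ 0 <= v & v < P.+1%:R].
  rewrite ltr_norml => /andP[h1 h2] /=; split.
    by rewrite mulr_ge0 ?ltW//; lra.
  rewrite /a mulrA ltr_pdivrMr ?mulr_gt0// (mulrC _ P.+1%:R) ltr_pM2l//; lra.
have [x1 x2] := aux x (xr i); have [y1 y2] := aux y (yr i).
have /ffunP/(_ i) := exy; rewrite !ffunE -/a => /(congr1 val) /=.
have hT (v : R) : 0 <= v -> v < P.+1%:R -> (Num.truncn v < P.+1)%N.
  move=> v0 v1; rewrite -(ltr_nat R); apply: le_lt_trans v1.
  by have /andP[] := truncn_itv v0.
rewrite !inordK ?hT// => e.
have /andP[tx1 tx2] := truncn_itv x1; have /andP[ty1 ty2] := truncn_itv y1.
rewrite -(ler_pM2r a0) /a [leRHS]mulrA divfK ?gt_eqF// divff ?gt_eqF ?mulr_gt0//.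
rewrite -/a -[a in leLHS]gtr0_norm// -normrM ler_norml.
move: tx1 tx2 ty1 ty2; rewrite e -!natr1.
set t := (Num.truncn _)%:R => *; apply/andP; split; nra.
Qed.

Variables (K : set 'rV[R]_n) (x0 : 'rV[R]_n) (r : R).
Variables (V : 'I_N -> 'rV[R]_n -> R -> Prop) (Z : 'I_N -> 'rV[R]_n -> seq R).

(* [V l x c] says that [c] is a root of a polynomial depending on [l] and [x],
   and [Z l x] lists the real parts of all its roots.  A cell of diameter
   [eps] in [K] excludes, for each [l], only [k] intervals of length of order
   [eps^(1/k)]; counting grid points, [n * k < N] leaves some box free. *)
Lemma generic_values (b : 'rV[R]_N) (rho : R) :
  (n * k < N)%N -> 0 < r -> K `<=` ball x0 r ->
  (forall l x, size (Z l x) = k) ->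
  (forall B, exists2 L, 0 <= L & forall l x y c, K x -> K y -> `|c| <= B ->
    V l x c -> \prod_(z <- Z l y) `|c - z| <= L * \sum_i `|x 0 i - y 0 i|) ->
  0 < rho ->
  exists b' rho', [/\ 0 < rho', ball b' rho' `<=` ball b rho &
    forall c, ball b' rho' c -> forall x, K x -> exists l, ~ V l x (c 0 l)].
Proof.
move=> nkN r0 Kr Zk HL rho0.
pose B := \sum_l `|b 0 l| + rho; have [L L0 {}HL] := HL B.
(* Chosen so that [L] times the diameter bound for a cell is below [s ^+ k] once each side is cut
   into [T * m ^ k] slices. *)
pose T := (Num.truncn (2 * L * n%:R * r * (8 / rho) ^+ k)).+1.
(* Number of grid values per coordinate, large enough for the final count. *)
pose m := (T ^ n * k ^ N).+1.
have m0 : 0 < m%:R :> R by [].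
pose P := (T * m ^ k).-1.
have PE : P.+1 = (T * m ^ k)%N by rewrite prednK// muln_gt0 expn_gt0.
pose s := rho / (8 * m%:R).
have s0 : 0 < s by rewrite divr_gt0// mulr_gt0.
have rhoE : rho = s * 8 * m%:R.
  by rewrite /s -mulrA divfK// gt_eqF// mulr_gt0.
(* A grid of [m ^ N] centers; neighboring values of a coordinate differ by [rho / m = 8 * s]. *)
pose g (u : {ffun 'I_N -> 'I_m}) : 'rV[R]_N :=
  \row_l (b 0 l + rho * ((u l)%:R / m%:R - 1 / 2)).
have subball u : ball (g u) s `<=` ball b rho.
  move=> c /(ball_rowP _ _ s0) cs; apply/(ball_rowP _ _ rho0) => l.
  have {cs} := cs l; rewrite mxE.
  have u0 : 0 <= (u l)%:R / m%:R :> R by rewrite divr_ge0.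
  have u1 : (u l)%:R / m%:R <= 1 :> R.
    by rewrite ler_pdivrMr// mul1r ler_nat ltnW.
  have : s <= rho / 8.
    rewrite /s ler_pM2l// lef_pV2 ?posrE ?mulr_gt0//.
    by rewrite -[leLHS]mulr1 ler_pM2l// ler1n.
  rewrite !ltr_norml => hs /andP[h1 h2]; apply/andP; split; nra.
apply: contrapT => Hn.
(* If no box is free, the box around each [g u] contains a parameter [c] that fails for every [l] at
   one point of [K]. *)
have bad u : exists cx : 'rV[R]_N * 'rV[R]_n,
    [/\ ball (g u) s cx.1, K cx.2 & forall l, V l cx.2 (cx.1 0 l)].
  apply: contrapT => Hu; apply: Hn; exists (g u), s; split => // c cb x Kx.
  apply: contrapT => Hl; apply: Hu; exists (c, x); split => // l.
  by apply: contrapT => Vl; apply: Hl; exists l.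
have {Hn bad} [cx Hcx] := choice bad.
pose cell u := row_cell P x0 r (cx u).2.
pose rep q := odflt [ffun=> ord0] [pick u | cell u == q].
have repP u : cell (rep (cell u)) = cell u.
  rewrite /rep; case: pickP => [v /eqP //|/(_ u)]; by rewrite eqxx.
(* The bad point is compared with the representative [y] of its cell: the product of the distances
   from [c] to the [k] listed values at [y] is below [s ^+ k], so one of them is within [s] of [c],
   hence within [2 * s] of the grid value. *)
have near_root u l : exists i : 'I_k,
    `|g u 0 l - (Z l (cx (rep (cell u))).2)`_i| < 2 * s.
  have [/(ball_rowP _ _ s0) cb Kx Vx] := Hcx u.
  have [_ Ky _] := Hcx (rep (cell u)).
  set y := (cx (rep (cell u))).2 in Ky *.
  set c := (cx u).1 0 l.
  have cB : `|c| <= B.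
    have /(ball_rowP _ _ rho0)/(_ l) hc : ball b rho (cx u).1.
      by apply: (subball u); apply/ball_rowP.
    have -> : c = b 0 l - (b 0 l - c) by rewrite opprB addrC subrK.
    apply: le_trans (ler_normB _ _) _; apply: lerD; last exact: ltW.
    by rewrite (bigD1 l)//= lerDl sumr_ge0.
  have hprod := HL l _ _ _ Kx Ky cB (Vx l).
  have hd := row_cell_dist r0 (Kr _ Kx) (Kr _ Ky) (esym (repP u)).
  have small : \prod_(z <- Z l y) `|c - z| < s ^+ k.
    apply: le_lt_trans hprod _; apply: le_lt_trans (ler_wpM2l L0 hd) _.
    have T0 : 0 < T%:R :> R by [].
    have -> : L * (n%:R * (2 * r / P.+1%:R)) =
        (2 * L * n%:R * r) / T%:R / m%:R ^+ k.
      by rewrite PE natrM natrX; field; rewrite expf_neq0 ?gt_eqF.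
    rewrite /s invfM mulrA expr_div_n ltr_pM2r ?invr_gt0 ?exprn_gt0//.
    rewrite ltr_pdivrMr// [ltRHS]mulrC -ltr_pdivrMr ?exprn_gt0 ?divr_gt0//.
    rewrite -exprVn invf_div.
    have /truncn_itv/andP[//] : 0 <= 2 * L * n%:R * r * (8 / rho) ^+ k.
    by rewrite !mulr_ge0 ?exprn_ge0 ?divr_ge0// ltW.
  have [i ik hi] : exists2 i, (i < k)%N & `|c - (Z l y)`_i| < s.
    apply: contrapT => Hi; move: small; rewrite ltNge => /negP; apply.
    rewrite (big_nth 0) Zk big_mkord -[X in s ^+ X]card_ord -prodr_const.
    apply: ler_prod => i _; rewrite ltW//= leNgt; apply/negP => hi.
    by apply: Hi; exists i.
  exists (Ordinal ik) => /=; have := cb l; rewrite -/c => h1.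
  have -> : g u 0 l - (Z l y)`_i = (g u 0 l - c) + (c - (Z l y)`_i) by ring.
  by rewrite (le_lt_trans (ler_normD _ _))// mulr2n mulrDl mul1r ltrD.
have [f Hf] := choice (fun ul => near_root ul.1 ul.2).
pose F u := (cell u, [ffun l => f (u, l)]).
(* Two grid values within [2 * s] of the same listed value are less than [4 * s] apart, hence
   equal. *)
have Finj : injective F.
  move=> u v [ecell ef]; apply/ffunP => l.
  have := Hf (u, l); have := Hf (v, l); rewrite /= ecell.
  move/ffunP/(_ l): ef; rewrite !ffunE => ->.
  set z := nth _ _ _; rewrite !mxE => h1 h2.
  have E (a : R) : rho * (a / m%:R - 1 / 2) = 8 * s * a - 4 * s * m%:R.
    by rewrite {1}rhoE; field; rewrite gt_eqF.
  move: h1 h2; rewrite !E !ltr_norml => /andP[h1 h2] /andP[h3 h4].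
  apply/val_inj; case: (ltngtP (u l) (v l)) => //;
    rewrite -(ler_nat R) -natr1 -(ler_pM2l s0) => h; exfalso; lra.
(* Injectivity gives [m ^ N <= (T * m ^ k) ^ n * k ^ N], against [n * k < N] and
   [T ^ n * k ^ N < m]. *)
have := leq_card F Finj; rewrite card_prod !card_ffun !card_ord PE.
rewrite expnMn -expnM leqNgt => /negP; apply.
have -> : (m ^ N = m ^ (k * n) * m ^ (N - k * n).-1.+1)%N.
  by rewrite -expnD prednK; first congr (_ ^ _)%N; lia.
rewrite [X in (X < _)%N]mulnAC [X in (X < _)%N]mulnC ltn_mul2l expn_gt0 /=.
by rewrite expnS (leq_trans (ltnSn _))// leq_pmulr// expn_gt0.
Qed.
End GenericValues.

(** * Lipschitz estimates for determinants with a parameter *)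

Section ShiftedMatrices.
Variables (R : realType) (n : nat).
Local Notation C := R[i].
Import Normc.
Local Open Scope complex_scope.

Lemma normcD (z w : C) : normc (z + w) <= normc z + normc w.
Proof. exact: le_normcD. Qed.

Definition rdist (x y : 'rV[R]_n) : R := \sum_i `|x 0 i - y 0 i|.

Lemma rdist_ge0 x y : 0 <= rdist x y. Proof. by apply: sumr_ge0. Qed.

(* Lipschitz in [x], uniformly for the parameter [c] in bounded sets. *)
Definition ulip (K : set 'rV[R]_n) (f : 'rV[R]_n -> R -> C) : Prop :=
  forall B, exists L M : R, [/\ 0 <= L, 0 <= M &
    forall c x y, `|c| <= B -> K x -> K y ->
      normc (f x c) <= M /\ normc (f x c - f y c) <= L * rdist x y].

Lemma normc_ge0 (z : C) : 0 <= normc z.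
Proof. by case: z => a b; exact: sqrtr_ge0. Qed.

Lemma normc_real (a : R) : normc a%:C = `|a|.
Proof. by rewrite /normc /= expr0n addr0 sqrtr_sqr. Qed.

Lemma normc_ge_Re (z : C) : `|complex.Re z| <= normc z.
Proof.
by case: z => a b; rewrite -sqrtr_sqr ler_wsqrtr// lerDl sqr_ge0.
Qed.

Lemma normc_le (z : C) : normc z <= `|complex.Re z| + `|complex.Im z|.
Proof.
have -> : z = (complex.Re z)%:C + 'i * (complex.Im z)%:C by rewrite -complexE.
rewrite (le_trans (normcD _ _))// normcM !normc_real.
have -> : normc ('i : C) = 1 by rewrite /= expr0n add0r expr1n sqrtr1.
rewrite mul1r lerD//; first by case: z => a b /=; rewrite !(mulr0, mul0r, mul1r, subr0, addr0).
by case: z => a b /=; rewrite !(mulr0, mul0r, mul1r, subr0, addr0, add0r).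
Qed.

Lemma ulip_sub K K' f : K' `<=` K -> ulip K f -> ulip K' f.
Proof.
move=> KK hf B; have [L [M [L0 M0 H]]] := hf B.
by exists L, M; split => // c x y cB /KK Kx /KK Ky; exact: H.
Qed.

Lemma ulip_param K (g : R -> C) :
  (forall B, exists M, forall c, `|c| <= B -> normc (g c) <= M) ->
  ulip K (fun _ => g).
Proof.
(* The maximum with 0 covers [B < 0], where [M] may be negative. *)
move=> hg B; have [M HM] := hg B; exists 0, (Num.max 0 M); split => //.
  by rewrite le_max lexx.
move=> c x y cB _ _; rewrite subrr normc0 mul0r; split => //.
by rewrite le_max HM ?orbT.
Qed.

Lemma ulip_cst K z : ulip K (fun _ _ => z).
Proof. by apply: ulip_param => B; exists (normc z). Qed.

Lemma ulipD K f g : ulip K f -> ulip K g -> ulip K (fun x c => f x c + g x c).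
Proof.
move=> hf hg B; have [L [M [L0 M0 H]]] := hf B; have [L' [M' [L0' M0' H']]] := hg B.
exists (L + L'), (M + M'); split; rewrite ?addr_ge0// => c x y cB Kx Ky.
have [h1 h2] := H c x y cB Kx Ky; have [h3 h4] := H' c x y cB Kx Ky.
split; first by rewrite (le_trans (normcD _ _))// lerD.
by rewrite opprD addrACA (le_trans (normcD _ _))// mulrDl lerD.
Qed.

(** This product estimate is the reason why [ulip] carries the bound [M] besides the Lipschitz
    constant. *)
Lemma ulipM K f g : ulip K f -> ulip K g -> ulip K (fun x c => f x c * g x c).
Proof.
move=> hf hg B; have [L [M [L0 M0 H]]] := hf B; have [L' [M' [L0' M0' H']]] := hg B.
exists (M * L' + L * M'), (M * M'); split; rewrite ?addr_ge0 ?mulr_ge0//.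
move=> c x y cB Kx Ky.
have [h1 h2] := H c x y cB Kx Ky; have [_ h4] := H' c x y cB Kx Ky.
have [h5 _] := H' c y x cB Ky Kx.
have -> : (M * L' + L * M') * rdist x y = M * (L' * rdist x y) + L * rdist x y * M'.
  by ring.
split; first by rewrite normcM ler_pM ?normc_ge0//; case: (H' c x y cB Kx Ky).
have -> : f x c * g x c - f y c * g y c =
  f x c * (g x c - g y c) + (f x c - f y c) * g y c by ring.
rewrite (le_trans (normcD _ _))// !normcM.
by apply: lerD; rewrite ler_pM ?normc_ge0.
Qed.

Lemma ulip_sum K (I : Type) (s : seq I) (P : pred I) (F : I -> 'rV[R]_n -> R -> C) :
  (forall i, ulip K (F i)) -> ulip K (fun x c => \sum_(i <- s | P i) F i x c).
Proof.
move=> hF; elim: s => [|i s ih] /=.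
  rewrite (_ : (fun _ => _) = fun _ _ => 0); first exact: ulip_cst.
  by apply/funext => x; apply/funext => c; rewrite big_nil.
case Pi : (P i).
  rewrite (_ : (fun _ => _) = fun x c => F i x c + \sum_(i <- s | P i) F i x c).
    exact: ulipD.
  by apply/funext => x; apply/funext => c; rewrite big_cons Pi.
rewrite (_ : (fun _ => _) = fun x c => \sum_(i <- s | P i) F i x c) //.
by apply/funext => x; apply/funext => c; rewrite big_cons Pi.
Qed.

Lemma ulip_prod K (I : Type) (s : seq I) (P : pred I) (F : I -> 'rV[R]_n -> R -> C) :
  (forall i, ulip K (F i)) -> ulip K (fun x c => \prod_(i <- s | P i) F i x c).
Proof.
move=> hF; elim: s => [|i s ih] /=.
  rewrite (_ : (fun _ => _) = fun _ _ => 1); first exact: ulip_cst.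
  by apply/funext => x; apply/funext => c; rewrite big_nil.
case Pi : (P i).
  rewrite (_ : (fun _ => _) = fun x c => F i x c * \prod_(i <- s | P i) F i x c).
    exact: ulipM.
  by apply/funext => x; apply/funext => c; rewrite big_cons Pi.
rewrite (_ : (fun _ => _) = fun x c => \prod_(i <- s | P i) F i x c) //.
by apply/funext => x; apply/funext => c; rewrite big_cons Pi.
Qed.

Lemma ulip_det K k (A : 'rV[R]_n -> R -> 'M[C]_k) :
  (forall i j, ulip K (fun x c => A x c i j)) -> ulip K (fun x c => \det (A x c)).
Proof.
by move=> hA; apply: ulip_sum => s; apply: ulipM; [exact: ulip_cst|exact: ulip_prod].
Qed.

Lemma ulip_near W (f : 'rV[R]_n -> C) x0 : open W -> W x0 ->
  Ck 1 W (fun x => complex.Re (f x)) -> Ck 1 W (fun x => complex.Im (f x)) ->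
  exists2 r, 0 < r & ulip (ball x0 r) (fun x _ => f x).
Proof.
move=> oW Wx0 hR hI.
have [r1 [L1 [r10 L10 _ H1]]] := Ck1_lipschitz_near oW Wx0 hR.
have [r2 [L2 [r20 L20 _ H2]]] := Ck1_lipschitz_near oW Wx0 hI.
pose r := Num.min r1 r2.
have r0 : 0 < r by rewrite lt_min r10.
have Lip x y : ball x0 r x -> ball x0 r y ->
    normc (f x - f y) <= (L1 + L2) * rdist x y.
  move=> xr yr; rewrite (le_trans (normc_le _))// mulrDl !raddfB /=; apply: lerD.
    by apply: H1; [apply: le_ball xr|apply: le_ball yr]; rewrite ge_min lexx.
  by apply: H2; [apply: le_ball xr|apply: le_ball yr]; rewrite ge_min lexx orbT.
exists r => // B.
exists (L1 + L2), (normc (f x0) + (L1 + L2) * (n%:R * r)); split.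
- exact: addr_ge0.
- by rewrite addr_ge0 ?normc_ge0// mulr_ge0 ?addr_ge0// mulr_ge0// ltW.
move=> c x y _ xr yr; split; last exact: Lip.
have -> : f x = f x0 + (f x - f x0) by ring.
rewrite (le_trans (normcD _ _))// lerD2l (le_trans (Lip _ _ xr _))//.
  exact: ballxx.
rewrite ler_wpM2l ?addr_ge0//.
have -> : n%:R * r = \sum_(i < n) r by rewrite sumr_const card_ord mulr_natl.
apply: ler_sum => i _; rewrite distrC ltW//.
by move: xr => /(ball_rowP _ _ r0).
Qed.

End ShiftedMatrices.

(** Completeness of matrix spaces, for the use of [Baire] on ['rV[R]_N]. *)
HB.instance Definition _ (R : realType) (m n : nat) :=
  Uniform_isComplete.Build 'M[R]_(m, n) cauchy_cvg.

(** * Baire category argument for shifted matrices *)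

Section GenericShift.
Variables (R : realType) (n k N : nat).
Local Notation C := R[i].
Import Normc.
Local Open Scope complex_scope.

(** The boxes with rational center and radius [1 / (m + 1)] form a countable base, which supplies
    the countable family required by Baire's theorem. *)
Lemma rat_box (y : 'rV[R]_n) (r : R) : 0 < r ->
  exists (q : 'rV[rat]_n) (m : nat),
    ball (map_mx ratr q : 'rV[R]_n) (m.+1%:R^-1) y /\
    ball (map_mx ratr q : 'rV[R]_n) m.+1%:R^-1 `<=` ball y r.
Proof.
move=> r0; pose m := Num.truncn (2 / r).
have [e eE] : exists e : R, e = m.+1%:R^-1 by eexists.
have m0 : 0 < e by rewrite eE invr_gt0.
have hm : e < r / 2.
  have /truncn_itv/andP[_ h] : 0 <= 2 / r by rewrite divr_ge0// ltW.
  by rewrite eE invf_plt ?posrE ?divr_gt0// invf_div.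
have hq (i : 'I_n) : exists q : rat, `|ratr q - y 0 i| < e.
  have [|q] := @rat_in_itvoo R (y 0 i - e) (y 0 i + e).
    by lra.
  by rewrite in_itv /= => /andP[h1 h2]; exists q; rewrite ltr_norml; apply/andP; split; lra.
have [q Hq] := choice hq.
exists (\row_i q i), m; rewrite -eE; split; first by apply/ball_rowP => // i; rewrite !mxE.
move=> z /(ball_rowP _ _ m0) hz; apply/ball_rowP => // i.
have -> : y 0 i - z 0 i = - (ratr (q i) - y 0 i) + (ratr (q i) - z 0 i) by ring.
rewrite (le_lt_trans (ler_normD _ _))// normrN.
have := Hq i; have := hz i; rewrite !mxE; lra.
Qed.

(** The determinant is the characteristic polynomial of [- A] at [c]. Since [c] is real, its
    distance to a complex root is at least its distance to the real part of that root. *)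
Lemma det_shift_roots (A : 'M[C]_k) :
  exists z : seq R, size z = k /\
    forall c : R, \prod_(a <- z) `|c - a| <= normc (\det (A + c%:C%:M)).
Proof.
have [z hz] := closed_field_poly_normal (char_poly (- A)).
move: hz; rewrite (eqP (char_poly_monic _)) scale1r => hz.
exists [seq complex.Re a | a <- z]; split=> [|c].
  have := size_char_poly (- A); rewrite hz size_prod_XsubC size_map => -[] //.
have -> : \det (A + c%:C%:M) = (char_poly (- A)).[c%:C].
  rewrite /char_poly -[RHS]/(horner_eval c%:C (\det (char_poly_mx (- A)))).
  rewrite -det_map_mx; congr (\det _); apply/matrixP => i j.
  rewrite !mxE /= /horner_eval. 
  rewrite -[RHS]/(('X *+ (i == j) - (- A i j)%:P).[c%:C]) hornerD hornerN.
  by rewrite hornerMn hornerX hornerC opprK addrC.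
rewrite hz horner_prod; elim: z {hz} => [|a z ih]; first by rewrite !big_nil normc1.
rewrite /= !big_cons normcM; apply: ler_pM => //; first by rewrite prodr_ge0.
rewrite hornerXsubC (le_trans _ (normc_ge_Re _))// raddfB /=.
by rewrite lexx.
Qed.

(** On each rational box where the determinants are uniformly Lipschitz, [generic_values] makes the
    good parameters contain a dense open set; these boxes cover [W], and Baire's theorem yields one
    parameter good on all of them. *)
Lemma generic_shift (W : set 'rV[R]_n) (A : 'I_N -> 'rV[R]_n -> 'M[C]_k) :
  (n * k < N)%N -> open W ->
  (forall l i j, Ck 1 W (fun x => complex.Re (A l x i j)) /\
                 Ck 1 W (fun x => complex.Im (A l x i j))) ->
  exists c : 'rV[R]_N, forall x, W x ->
    exists l, \det (A l x + (c 0 l)%:C%:M) != 0.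
Proof.
move=> nkN oW hA.
pose f l x c := \det (A l x + c%:C%:M).
have near_ulip x : W x -> exists2 r, 0 < r & forall l, ulip (ball x r) (f l).
  move=> Wx.
  have h (lij : 'I_N * ('I_k * 'I_k)) : \forall r \near (0 : R)^'+,
      ulip (ball x r) (fun y _ => A lij.1 y lij.2.1 lij.2.2).
    have [hR hI] := hA lij.1 lij.2.1 lij.2.2.
    have [r r0 hr] := ulip_near oW Wx hR hI.
    near=> s; apply: ulip_sub hr; apply: le_ball; apply: ltW.
    by near: s; exact: nbhs_right_lt.
  have {}h := @filter_forall _ _ (fun lij r => ulip (ball x r)
    (fun y _ => A lij.1 y lij.2.1 lij.2.2)) _ (at_right_proper_filter 0) h.
  have [r [r0 hr]] := @filter_ex _ _ (at_right_proper_filter (0 : R)) _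
    (filterI (nbhs_right_gt 0) h).
  exists r => // l; apply: ulip_det => i j.
  rewrite (_ : (fun _ => _) = fun y c => A l y i j + c%:C *+ (i == j)); last first.
    by apply/funext => y; apply/funext => c; rewrite !mxE.
  apply: ulipD; first exact: (hr (l, (i, j))).
  apply: ulip_param => B; exists B => c cB.
  case: (i == j); last by rewrite mulr0n normc0 (le_trans _ cB).
  by rewrite mulr1n normc_real.
have [Z HZ] := choice (fun lx : 'I_N * 'rV[R]_n => det_shift_roots (A lx.1 lx.2)).
pose Q (u : 'rV[rat]_n * nat) : set 'rV[R]_n := ball (map_mx ratr u.1 : 'rV[R]_n) u.2.+1%:R^-1.
pose good (c : 'rV[R]_N) (x : 'rV[R]_n) := exists l, f l x (c 0 l) != 0.
(* Codes of no box, or of a box without the Lipschitz property, contribute [setT], so that [F] is a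
   sequence of dense open sets. *)
pose F (i : nat) : set 'rV[R]_N :=
  if unpickle i is Some u then
    if `[< (forall l, ulip (Q u) (f l)) >] then
      interior [set c | forall x, Q u x -> good c x] else setT
  else setT.
have HF i : open (F i) /\ dense (F i).
  rewrite /F; case: unpickle => [u|]; last first.
    by split=> [|O [z Oz] _]; [exact: openT|exists z].
  case: (asboolP (forall l, ulip (Q u) (f l))) => [hu|_]; last first.
    by split=> [|O [z Oz] _]; [exact: openT|exists z].
  split; first exact: open_interior.
  move=> O [z Oz] oO.
  have /nbhs_ballP[rho rho0 hrho] := open_nbhs_nbhs (conj oO Oz).
  have m0 : 0 < u.2.+1%:R^-1 :> R by rewrite invr_gt0.
  have [|B|b' [rho' [rho'0 bb' hb']]] := generic_values (K := Q u)
    (V := fun l x c => f l x c = 0) (Z := fun l x => Z (l, x)) z nkN m0 (fun x => id) _ _ rho0.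
  - by move=> l x; have [] := HZ (l, x).
  - have [L HL] := choice (fun l => hu l B).
    have [M {}HL] := choice HL.
    exists (\sum_l L l) => [|l x y c Kx Ky cB Vl].
      by apply: sumr_ge0 => l _; have [] := HL l.
    have [_ /(_ c)/le_trans] := HZ (l, y); apply.
    have [_ _ /(_ c y x cB Ky Kx)[_]] := HL l.
    rewrite Vl subr0 => /le_trans; apply.
    have -> : rdist y x = rdist x y by apply: eq_bigr => j _; rewrite distrC.
    rewrite ler_wpM2r ?rdist_ge0// (bigD1 l)//= lerDl sumr_ge0// => j _.
    by have [] := HL j.
  - exists b'; split; first by apply/hrho/bb'; exact: ballxx.
    apply/nbhs_ballP; exists rho' => // c cb x Qx.
    by have [l hl] := hb' c cb x Qx; exists l; apply/eqP.
have [|c [_ Hc]] := Baire HF _ (@openT _); first by exists 0.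
exists c => x Wx.
have [r r0 hr] := near_ulip x Wx; have [q [m [qx qsub]]] := rat_box x r0.
have {}hr l : ulip (Q (q, m)) (f l) by apply: ulip_sub (hr l).
have := Hc (pickle (q, m)) I; rewrite /F pickleK asboolT//.
by move=> /interior_subset; apply.
Unshelve. all: by end_near. Qed.
End GenericShift.

(** * Finitely many sections spanning every fiber *)

Section ManifoldBumps.
Variables (R : realType) (n : nat) (M : smoothManifold R n).
Implicit Types (U : set M) (f g : M -> R).
Local Notation C := R[i].
Local Notation "x %:C" := (real_complex R x) : ring_scope.

Definition rsmooth U f : Prop := smooth_on U (fun x => (f x)%:C).

Lemma rsmooth_cst U a : rsmooth U (fun=> a).
Proof. exact: smooth_on_cst. Qed.

Lemma rsmooth_ext U f g : open U -> (forall x, U x -> f x = g x) ->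
  rsmooth U f -> rsmooth U g.
Proof. by move=> oU fg; apply: smooth_on_ext => // x Ux; rewrite fg. Qed.

Lemma rsmoothD U f g : open U -> rsmooth U f -> rsmooth U g ->
  rsmooth U (fun x => f x + g x).
Proof.
move=> oU hf hg; apply: (smooth_on_ext oU _ (smooth_onD oU hf hg)) => x _.
by rewrite rmorphD.
Qed.

Lemma rsmoothM U f g : open U -> rsmooth U f -> rsmooth U g ->
  rsmooth U (fun x => f x * g x).
Proof.
move=> oU hf hg; apply: (smooth_on_ext oU _ (smooth_onM oU hf hg)) => x _.
by rewrite rmorphM.
Qed.

Lemma rsmoothB U f g : open U -> rsmooth U f -> rsmooth U g ->
  rsmooth U (fun x => f x - g x).
Proof.
move=> oU hf hg; apply: (rsmooth_ext oU _
  (rsmoothD oU hf (rsmoothM oU (rsmooth_cst U (-1)) hg))) => x _.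
by rewrite mulN1r.
Qed.

Lemma rsmooth_prod U (I : Type) (r : seq I) (P : pred I) (F : I -> M -> R) :
  open U -> (forall i, P i -> rsmooth U (F i)) ->
  rsmooth U (fun x => \prod_(i <- r | P i) F i x).
Proof.
move=> oU hF; apply: (smooth_on_ext oU _ (smooth_on_prod r oU hF)) => x _.
by rewrite rmorph_prod.
Qed.

Lemma rsmooth_flat m U f : open U -> rsmooth U f ->
  rsmooth U (fun x => flat m (f x)).
Proof.
move=> oU hf c Ac; have [h1 _] := hf c Ac; split=> k; last exact: Ck_cst.
by have := Ck_flat m (chart_image_open (c := c) oU) (h1 k).
Qed.

Lemma rsmooth_sqrt U f : open U -> (forall x, U x -> 0 < f x) -> rsmooth U f ->
  rsmooth U (fun x => Num.sqrt (f x)).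
Proof.
move=> oU f0 hf c Ac; have [h1 _] := hf c Ac; split=> k; last exact: Ck_cst.
apply: (Ck_sqrt (chart_image_open (c := c) oU) _ (h1 k)) => _ [x [cx Ux] <-].
by rewrite ch_mapK//; exact: f0.
Qed.

Lemma rsmoothV U f : open U -> (forall x, U x -> f x != 0) -> rsmooth U f ->
  rsmooth U (fun x => (f x)^-1).
Proof.
move=> oU f0 hf; apply: (smooth_on_ext oU _ (smooth_onV oU _ hf)) => x Ux.
  by rewrite fmorphV.
by rewrite fmorph_eq0 f0.
Qed.

Lemma rsmooth_coord (c : chart R n M) i : mf_atlas c ->
  rsmooth (ch_dom c) (fun x => ch_map c x 0 i).
Proof.
move=> Ac d Ad; split; first exact: mf_compat.
by move=> k; exact: Ck_cst.
Qed.

Lemma rsmooth_continuous U f x : open U -> U x -> rsmooth U f ->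
  {for x, continuous f}.
Proof.
move=> oU Ux hf; have [c Ac cx] := mf_cover x.
have [/(_ 0%N) h _] := hf c Ac.
have /(Ck_cont h) hc : (ch_map c @` (ch_dom c `&` U)) (ch_map c x) by exists x.
have := continuous_comp (ch_map_cont cx) hc.
rewrite /prop_for /continuous_at /= ch_mapK//; apply: cvg_trans.
apply: near_eq_cvg; have := open_nbhs_nbhs (conj (@ch_dom_open _ _ _ c) cx).
by apply: filterS => y cy /=; rewrite ch_mapK.
Qed.

Lemma rsmooth_open f : rsmooth setT f -> open [set x | 0 < f x].
Proof.
move=> hf; have cf : continuous f by move=> x; exact: (rsmooth_continuous openT I hf).
by have := (continuousP _).1 cf _ (@open_gt _ 0).
Qed.

(** A cube in the chart image of [V] is compact, so its preimage [S] is closed because [M] is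
    Hausdorff. A product of flat functions positive exactly inside the cube therefore extends by
    zero to a smooth function on [M]. *)
Lemma smooth_bump (V : set M) x : open V -> V x ->
  exists c (psi : M -> R) (S : set M),
  [/\ mf_atlas c, rsmooth setT psi, forall y, 0 <= psi y, 0 < psi x &
      [/\ closed S, S `<=` ch_dom c `&` V & forall y, ~ S y -> psi y = 0]].
Proof.
move=> oV Vx; have [c Ac cx] := mf_cover x.
pose O := ch_map c @` (ch_dom c `&` V); pose y0 := ch_map c x.
have Oy0 : O y0 by exists x.
have /nbhs_ballP[r r0 hr] := open_nbhs_nbhs (conj (chart_image_open (c := c) oV) Oy0).
have r20 : 0 < r / 2 by rewrite divr_gt0.
pose K : set 'rV[R]_n := [set y | forall i, `[y0 0 i - r / 2, y0 0 i + r / 2]%classic (y 0 i)].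
have cK : compact K.
  by apply: (@rV_compact _ _ (fun i => `[y0 0 i - r / 2, y0 0 i + r / 2]%classic)) => i;
     exact: segment_compact.
have KO : K `<=` O.
  move=> y Ky; apply: hr; apply/ball_rowP => // i; have := Ky i.
  by rewrite /= in_itv /= ltr_norml => /andP[? ?]; apply/andP; split; lra.
pose S := ch_inv c @` K.
have SV : S `<=` ch_dom c `&` V.
  by move=> _ [y /KO[z [cz Vz] <-] <-]; rewrite ch_mapK.
have cS : closed S.
  apply: compact_closed; first exact: mf_hausdorff.
  apply: continuous_compact => //; apply: continuous_in_subspaceT => y.
  rewrite inE => /KO [z [cz _] <-]; apply: ch_inv_cont; by exists z.
pose b (z : M) := \prod_(i < n)
  (flat 0 (r / 2 - (ch_map c z 0 i - y0 0 i)) * flat 0 (r / 2 + (ch_map c z 0 i - y0 0 i))).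
pose psi z := if `[< ch_dom c z >] then b z else 0.
have psi0 z : ~ S z -> psi z = 0.
  rewrite /psi; case: asboolP => // cz nS; apply/eqP; apply: contrapT => /negP nb.
  apply: nS; exists (ch_map c z); last by rewrite ch_mapK.
  move=> i /=; rewrite in_itv /=.
  have hn m (t : R) : flat m t != 0 -> 0 < t.
    by move=> ft; rewrite -(flat_gt0 m) lt_neqAle eq_sym ft flat_ge0.
  have /prodf_neq0/(_ i isT) := nb; rewrite mulf_eq0 negb_or => /andP[h1 h2].
  by have := hn _ _ h1; have := hn _ _ h2; move=> ? ?; apply/andP; split; lra.
exists c, psi, S; split => //.
(* Smoothness is local: it is checked on the chart domain and on the complement of [S], which cover
   [M]. *)
- rewrite (_ : setT = \bigcup_(u in [set: bool]) (if u then ch_dom c else ~` S)); last first.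
    apply/esym; rewrite -subTset => z _; have [cz|ncz] := pselect (ch_dom c z).
      by exists true.
    by exists false => //= /SV[].
  apply: smooth_on_cover => -[] _; last first.
    have oS : open (~` S) by exact: closed_openC.
    by apply: (rsmooth_ext oS _ (rsmooth_cst _ 0)) => z /psi0.
  have oc := @ch_dom_open _ _ _ c.
  apply: (rsmooth_ext (f := b) oc) => [z cz|]; first by rewrite /psi asboolT.
  apply: rsmooth_prod => // i _; have hi := rsmooth_coord i Ac.
  have hb := rsmoothB oc hi (rsmooth_cst _ (y0 0 i)).
  apply: rsmoothM => //; apply: rsmooth_flat => //.
    exact: (rsmoothB oc (rsmooth_cst _ (r / 2)) hb).
  exact: (rsmoothD oc (rsmooth_cst _ (r / 2)) hb).
- move=> z; rewrite /psi; case: ifP => // _; apply: prodr_ge0 => i _.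
  by rewrite mulr_ge0 ?flat_ge0.
- rewrite /psi asboolT//; apply: prodr_gt0 => i _.
  by rewrite subrr subr0 addr0 mulr_gt0 ?flat_gt0.
Qed.
End ManifoldBumps.

(** * Local frames multiplied by bump functions *)

Section BumpFrames.
Variables (R : realType) (n : nat) (M : smoothManifold R n) (k : nat).
Variable E : vectorBundle M k.
Local Notation C := R[i].
Local Notation "x %:C" := (real_complex R x) : ring_scope.

Lemma sections_sumE (T : Type) (F : T -> lmodType C) (P : Defs.subspace F) (I : Type)
    (r : seq I) (Q : pred I) (s : I -> sections P) x :
  (\sum_(i <- r | Q i) s i) x = \sum_(i <- r | Q i) s i x.
Proof. by elim/big_rec2: _ => //= i u v _ <-. Qed.

Definition bump_frame (psi : M -> R) (tau : 'I_k -> Gamma E) : Prop :=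
  [/\ rsmooth setT psi, forall y, 0 <= psi y &
   forall x, 0 < psi x -> exists c t, [/\ mf_atlas c, vb_atlas t,
     forall y, 0 < psi y -> ch_dom c y /\ tr_dom t y &
     forall i y, tau i y = (psi y)%:C *: tr_frame t i y]].

Lemma bump_frame0 : bump_frame (fun=> 0) (fun=> 0).
Proof. by split=> [|//|x]; [exact: rsmooth_cst|rewrite ltxx]. Qed.

Lemma bump_frame_exists x : exists psi tau, bump_frame psi tau /\ 0 < psi x.
Proof.
have [t At tx] := vb_cover E x.
have oT (t' : trivialization E k) : open (tr_dom t') := @tr_dom_open _ _ _ _ _ t'.
have [c [psi [S [Ac spsi psi0 psix [cS Sdom psiS]]]]] := smooth_bump (oT t) tx.
have hs i : smooth_section (fun y => (psi y)%:C *: tr_frame t i y : E y).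
  move=> t' At' i'.
  have -> : tr_dom t' = \bigcup_(u in [set: bool])
      (if u then tr_dom t `&` tr_dom t' else tr_dom t' `&` ~` S).
    apply/seteqP; split=> [z tz|z [[] _ []//]].
    have [Sz|nSz] := pselect (S z); last by exists false.
    by exists true => //=; have [_ ?] := Sdom _ Sz.
  apply: smooth_on_cover => -[] _; last first.
    have oS : open (tr_dom t' `&` ~` S) by apply: openI => //; exact: closed_openC.
    apply: (smooth_on_ext oS _ (smooth_on_cst _ 0)) => z [_ /psiS ->].
    by rewrite scale0r tr_coord0.
  have oI : open (tr_dom t `&` tr_dom t') by exact: openI.
  apply: (smooth_on_ext oI _ (smooth_onM oI _ (vb_compat At At' i' i))) => [z _|].
    by rewrite tr_coordZ.
  exact: smooth_on_sub spsi.
exists psi, (fun i => @Sections _ _ _ (section_subspace E) _ (hs i)); split => //.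
split => // _ _; exists c, t; split => // y psiy.
have [Sy|/psiS py] := pselect (S y); first exact: Sdom.
by rewrite py ltxx in psiy.
Qed.

(** Lindelof argument: to each base set on which some bump function is positive one such bump is
    assigned, indexed by the code [f U]; the remaining indices receive zero. *)
Lemma bump_frames : exists (psi : nat -> M -> R) (tau : nat -> 'I_k -> Gamma E),
  (forall j, bump_frame (psi j) (tau j)) /\ forall x, exists j, 0 < psi j x.
Proof.
have [B /countable_injP[f finj] [Bo Bb]] := mf_second_countable M.
pose small (U : set M) (p : (M -> R) * ('I_k -> Gamma E)) :=
  bump_frame p.1 p.2 /\ forall x, U x -> 0 < p.1 x.
have H j : exists p : (M -> R) * ('I_k -> Gamma E), bump_frame p.1 p.2 /\
    forall U, B U -> f U = j -> (exists p, small U p) -> forall x, U x -> 0 < p.1 x.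
  have [[U [BU fU [p [hp1 hp2]]]]|h] :=
      pselect (exists U, [/\ B U, f U = j & exists p, small U p]).
    exists p; split => // U' BU' fU' _.
    by have -> : U' = U by apply: finj; rewrite ?inE// fU.
  exists ((fun=> 0), (fun=> 0)); split; first exact: bump_frame0.
  by move=> U BU fU hU; exfalso; apply: h; exists U.
have [p Hp] := choice H.
exists (fun j => (p j).1), (fun j => (p j).2); split => [j|x]; first by have [] := Hp j.
have [psi [tau [bf psix]]] := bump_frame_exists x.
have [sp _ _] := bf.
have h : filter_from [set U | B U /\ U x] id [set y | 0 < psi y].
  exact: (Bb x _ (open_nbhs_nbhs (conj (rsmooth_open sp) psix))).
case: h => U /= [BU Ux] Usub.
exists (f U); have [_ hU] := Hp (f U); apply: (hU U) => //.
by exists (psi, tau); split.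
Qed.
End BumpFrames.

(** * Making the bump family locally finite *)

Section LocallyFinite.
Variables (R : realType) (n : nat) (M : smoothManifold R n).
Variable psi : nat -> M -> R.
Hypothesis psi_smooth : forall j, rsmooth setT (psi j).
Hypothesis psi_ge0 : forall j x, 0 <= psi j x.
Hypothesis psi_cover : forall x, exists j, 0 < psi j x.

(* Positive exactly where [psi j > 0] and all earlier [psi i] are below
   [1 / (j + 1)]; this makes the family locally finite. *)
Definition cutoff (j : nat) (x : M) : R :=
  psi j x * \prod_(i < j) flat 0 (j.+1%:R^-1 - psi i x).

Lemma cutoff_smooth j : rsmooth setT (cutoff j).
Proof.
apply: rsmoothM => //; first exact: openT.
apply: rsmooth_prod => [|i _]; first exact: openT.
apply: rsmooth_flat; first exact: openT.
by apply: rsmoothB; [exact: openT|exact: rsmooth_cst|exact: psi_smooth].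
Qed.

Lemma cutoff_ge0 j x : 0 <= cutoff j x.
Proof. by rewrite mulr_ge0// prodr_ge0// => i _; exact: flat_ge0. Qed.

Lemma cutoff_gt0 j x : 0 < cutoff j x -> 0 < psi j x.
Proof.
rewrite /cutoff lt_neqAle eq_sym mulf_eq0 negb_or => /andP[/andP[h _] _].
by rewrite lt_neqAle eq_sym h psi_ge0.
Qed.

(** At the first [j] with [psi j x > 0] all earlier functions vanish, so every factor of the product
    is positive. *)
Lemma cutoff_cover x : exists j, 0 < cutoff j x.
Proof.
have [j psij jmin] := ex_minnP (psi_cover x).
exists j; rewrite mulr_gt0// prodr_gt0// => i _.
have -> : psi i x = 0.
  apply/eqP; rewrite eq_le psi_ge0 andbT leNgt; apply/negP => /jmin.
  by rewrite leqNgt ltn_ord.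
by rewrite subr0 flat_gt0 invr_gt0.
Qed.

Lemma cutoff_locally_finite x : exists (U : set M) (J : nat),
  [/\ open U, U x & forall y, U y -> forall j, (J <= j)%N -> cutoff j y = 0].
Proof.
have [i psii] := psi_cover x.
pose e := psi i x / 2; have e0 : 0 < e by rewrite divr_gt0.
(* For [j >= J] the factor of index [i] occurs in [cutoff j] and [1 / (j + 1) <= e]; where
   [psi i > e] this factor vanishes. *)
pose J := maxn i.+1 (Num.truncn e^-1).
exists [set y | 0 < psi i y - e], J; split.
- by apply: rsmooth_open; apply: rsmoothB; [exact: openT|exact: psi_smooth|exact: rsmooth_cst].
- by rewrite /= /e; lra.
move=> y /= hy j; rewrite geq_max => /andP[ij Jj].
rewrite /cutoff (bigD1 (Ordinal ij))//= flat_le0 ?mul0r ?mulr0//.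
rewrite subr_le0 (@le_trans _ _ e)//; last by rewrite -subr_ge0 ltW.
rewrite -[e]invrK lef_pV2 ?posrE ?invr_gt0//.
have /truncn_itv/andP[_ h] : 0 <= e^-1 by rewrite invr_ge0 ltW.
by rewrite (le_trans (ltW h))// ler_nat.
Qed.
End LocallyFinite.

(** * Finitely many generating sections *)

Section Generators.
Variables (R : realType) (n : nat) (M : smoothManifold R n) (k : nat).
Variable E : vectorBundle M k.
Local Notation C := R[i].
Local Notation "x %:C" := (real_complex R x) : ring_scope.

Definition spanning (I : finType) x (v : I -> E x) : Prop :=
  forall w, exists a : I -> C, w = \sum_i a i *: v i.

Lemma det_coord_spanning (t : trivialization E k) x (v : 'I_k -> E x) :
  tr_dom t x -> \det (\matrix_(i, j) tr_coord t j (v i)) != 0 -> spanning v.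
Proof.
move=> tx; set A := \matrix_(i, j) _ => dA w.
have uA : A \in unitmx by rewrite unitmxE unitfE.
pose r : 'rV[C]_k := \row_j tr_coord t j w.
exists (fun i => (r *m invmx A) 0 i).
rewrite [LHS](tr_frame_span w tx) [RHS](tr_frame_span _ tx).
apply: eq_bigr => j _; congr (_ *: _); rewrite tr_coord_sum.
have -> : tr_coord t j w = (r *m invmx A *m A) 0 j by rewrite mulmxKV// mxE.
rewrite mxE; apply: eq_bigr => i _; rewrite tr_coordZ; congr (_ * _).
by rewrite mxE.
Qed.

(** In the trivialization [t] the coordinate matrix of the family is [a] times [A l] shifted by
    [c 0 l], with [a = phi * psi] positive on [U]; [generic_shift] in the chart then provides
    [c]. *)
Lemma generic_frame N (psi phi : M -> R) (tau : 'I_k -> Gamma E)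
    (S : 'I_N -> 'I_k -> Gamma E) :
  (n * k < N)%N -> bump_frame psi tau -> rsmooth setT phi ->
  (forall x, 0 < phi x -> 0 < psi x) ->
  exists c : 'rV[R]_N, forall x, 0 < phi x -> exists l,
    spanning (fun i => S l i x + (c 0 l * phi x)%:C *: tau i x).
Proof.
move=> nkN [spsi psi0 hpsi] sphi phipsi.
have [[x0 phi0]|nphi] := pselect (exists x, 0 < phi x); last first.
  by exists 0 => x phix; exfalso; apply: nphi; exists x.
have [c [t [Ac At dom tauE]]] := hpsi _ (phipsi _ phi0).
pose U := [set x | 0 < phi x]; have oU : open U by exact: rsmooth_open.
have Ut : U `<=` tr_dom t by move=> x /phipsi/dom[].
have Uc : U `<=` ch_dom c by move=> x /phipsi/dom[].
pose W := ch_map c @` (ch_dom c `&` U).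
pose a x := phi x * psi x.
have a_gt0 x : U x -> 0 < a x by move=> Ux; rewrite mulr_gt0// phipsi.
pose A l x : 'M[C]_k := \matrix_(i, j) ((a x)%:C^-1 * tr_coord t j (S l i x)).
have sA l i j : smooth_on U (fun x => A l x i j).
  apply: (@smooth_on_ext _ _ _ _ (fun x => (a x)%:C^-1 * tr_coord t j (S l i x))) => //.
    by move=> x _; rewrite mxE.
  apply: smooth_onM => //; last exact: smooth_on_sub (sec_pred (S l i) t At j).
  apply: smooth_onV => // [x /a_gt0 a0|]; first by rewrite fmorph_eq0 gt_eqF.
  by apply: rsmoothM => //; [exact: smooth_on_sub sphi|exact: smooth_on_sub spsi].
have [||b hb] := @generic_shift R n k N W (fun l y => A l (ch_inv c y)) nkN.
- exact: chart_image_open.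
- by move=> l i j; have [h1 h2] := sA l i j c Ac; split; [exact: h1|exact: h2].
exists b => x Ux; have [|l] := hb (ch_map c x).
  by exists x => //; split => //; exact: Uc.
rewrite ch_mapK; last exact: Uc.
move=> hdet; exists l; apply: (det_coord_spanning (t := t)); first exact: Ut.
have a0 : (a x)%:C != 0 by rewrite fmorph_eq0 gt_eqF// a_gt0.
rewrite (_ : (\matrix_(i, j) _) = (a x)%:C *: (A l x + (b 0 l)%:C%:M)).
  by rewrite detZ mulf_neq0// expf_neq0.
apply/matrixP => i j; rewrite !mxE tr_coordD tr_coordZ tauE tr_coordZ.
rewrite tr_coord_frame; last exact: Ut.
rewrite mulrDr mulVKf// eq_sym; congr (_ + _).
by rewrite -[in RHS]mulr_natr /a !rmorphM /=; ring.
Qed.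

(* If [j] is the last index with [phi j x > 0], the [S j.+1 l i x] are the final
   values at [x], so [c j] alone decides whether they form a frame there. *)
Lemma finite_generators : exists (I : finType) (s : I -> Gamma E),
  forall x, spanning (fun i => s i x).
Proof.
have [psi [tau [Hbf psi_cover]]] := bump_frames E.
have psi_smooth j : rsmooth setT (psi j) by have [] := Hbf j.
have psi_ge0 j x : 0 <= psi j x by have [] := Hbf j.
pose phi := cutoff psi; pose N := (n * k).+1.
have phi_smooth j : rsmooth setT (phi j) by exact: cutoff_smooth.
pose phiC j : smooth_fun M := @Sections _ _ _ (smooth_fun_subspace M) _ (phi_smooth j).
pose sig j i : Gamma E := fun_scale (tau j i) (phiC j).
have sigE j i x : sig j i x = (phi j x)%:C *: tau j i x by [].
have Hc (jS : nat * ('I_N -> 'I_k -> Gamma E)) : exists c : 'rV[R]_N,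
    forall x, 0 < phi jS.1 x -> exists l,
    spanning (fun i => (jS.2 l i + (c 0 l)%:C *: sig jS.1 i) x).
  have [c hc] := generic_frame jS.2 (ltnSn (n * k)) (Hbf jS.1) (phi_smooth _)
    (cutoff_gt0 psi_ge0 (j := jS.1)).
  exists c => x /hc[l hl]; exists l => w; have [a ->] := hl w; exists a.
  apply: eq_bigr => i _; congr (_ *: _).
  rewrite -[RHS]/(jS.2 l i x + (c 0 l)%:C *: ((phi jS.1 x)%:C *: tau jS.1 i x)).
  by rewrite scalerA -rmorphM.
have {Hc} [c Hc] := choice Hc.
(* Partial sums; the coefficients of stage [j] are chosen after, and depending on, the sum [S j]
   already built. *)
pose fix S j : 'I_N -> 'I_k -> Gamma E := if j is j'.+1 then
  fun l i => S j' l i + (c (j', S j') 0 l)%:C *: sig j' i else fun _ _ => 0.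
have Sstable l i x J : (forall j, (J <= j)%N -> phi j x = 0) ->
    forall j, (J <= j)%N -> S j l i x = S J l i x.
  move=> hJ; elim=> [|j ih]; first by rewrite leqn0 => /eqP ->.
  rewrite leq_eqVlt => /orP[/eqP -> //|]; rewrite ltnS => Jj.
  rewrite -[LHS]/(S j l i x + (c (j, S j) 0 l)%:C *: ((phi j x)%:C *: tau j i x)).
  by rewrite hJ// rmorph0 scale0r scaler0 addr0 ih.
have /choice[U HU] := cutoff_locally_finite psi_smooth psi_cover.
have {HU} /choice[J HJ] := HU.
(* The limit section: on [U x] it agrees with the smooth section [S (J x) l i], since the partial
   sums have stabilized there. *)
have hs l i : smooth_section (fun x => S (J x) l i x : E x).
  move=> t At j.
  have -> : tr_dom t = \bigcup_(x in [set: M]) (U x `&` tr_dom t).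
    apply/seteqP; split=> [x tx|x [y _ []//]]; exists x => //; split => //.
    by have [] := HJ x.
  apply: smooth_on_cover => x _; have [oU Ux hx] := HJ x.
  have oI : open (U x `&` tr_dom t) by apply: openI => //; exact: tr_dom_open.
  have hsub : smooth_on (U x `&` tr_dom t) (fun y => tr_coord t j (S (J x) l i y)).
    by apply: smooth_on_sub (sec_pred (S (J x) l i) t At j) => y [].
  apply: (smooth_on_ext oI _ hsub) => y [Uy _]; congr (tr_coord _ _ _).
  have [_ Uyy hy] := HJ y.
  have [Jxy|/ltnW Jyx] := leqP (J x) (J y).
    by rewrite (Sstable _ _ _ _ (hx y Uy)).
  by rewrite -(Sstable _ _ _ _ (hy y Uyy) (J x)).
exists ('I_N * 'I_k)%type.
exists (fun li => @Sections _ _ _ (section_subspace E) _ (hs li.1 li.2)) => x /=.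
have [_ Uxx hx] := HJ x.
have ex : exists j, 0 < phi j x := cutoff_cover psi_ge0 psi_cover x.
have bnd j : 0 < phi j x -> (j <= J x)%N.
  by move=> phij; rewrite leqNgt; apply/negP => /ltnW/(hx x Uxx) e; rewrite /phi e ltxx in phij.
have [j phij jmax] := ex_maxnP ex bnd.
have hz i : (j.+1 <= i)%N -> phi i x = 0.
  move=> ji; apply/eqP; rewrite eq_le cutoff_ge0// andbT leNgt.
  by apply/negP => /jmax; rewrite leqNgt ji.
have jJ : (j.+1 <= J x)%N.
  by rewrite ltnNge; apply/negP => /(hx x Uxx) e; rewrite /phi e ltxx in phij.
have [l hl] := Hc (j, S j) x phij => w; have [a ->] := hl w.
exists (fun li => if li.1 == l then a li.2 else 0).
rewrite (bigID (fun li : 'I_N * 'I_k => li.1 == l)) /= [X in _ + X]big1 ?addr0; last first.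
  by move=> li /negbTE ->; rewrite scale0r.
transitivity (\sum_(l' | l' == l) \sum_(i < k) a i *: S (J x) l' i x).
  rewrite big_pred1_eq; apply: eq_bigr => i _; congr (_ *: _).
  by rewrite (Sstable _ _ _ _ hz _ jJ).
rewrite pair_big_dep /=; apply: eq_big => [[l' i]|[l' i]] /=; first by rewrite andbT.
by rewrite andbT => ->.
Qed.
End Generators.

(** * Positivity *)

Section TensorForm.
Variables (C : numClosedFieldType) (B A : starAlgebra C) (X : bimodule B A).
Variable ip : X -> X -> A.
Hypothesis ipP : right_inner_product ip.

Section Form.
Variables (H : preHilbert C) (rho : starRepresentation A H).

Lemma ph_ip0 (v : H) : ph_ip v 0 = 0.
Proof. by rewrite -(scale0r 0) ph_ipZ mul0r. Qed.

Lemma ph_ip_sum (v : H) (I : Type) (r : seq I) (Q : pred I) (F : I -> H) :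
  ph_ip v (\sum_(i <- r | Q i) F i) = \sum_(i <- r | Q i) ph_ip v (F i).
Proof. exact: (big_morph _ (ph_ipD v) (ph_ip0 v)). Qed.

Lemma ph_ip_suml (v : H) (I : Type) (r : seq I) (Q : pred I) (F : I -> H) :
  ph_ip (\sum_(i <- r | Q i) F i) v = \sum_(i <- r | Q i) ph_ip (F i) v.
Proof.
rewrite ph_ip_herm ph_ip_sum rmorph_sum; apply: eq_bigr => i _.
by rewrite [RHS]ph_ip_herm.
Qed.

Lemma ph_ip_ge0 (v : H) : 0 <= ph_ip v v.
Proof. by have [->|/ph_ip_pos/ltW//] := eqVneq v 0; rewrite ph_ip0. Qed.

Lemma rep_map_sum (I : Type) (r : seq I) (Q : pred I) (F : I -> A) v :
  rho (\sum_(i <- r | Q i) F i) v = \sum_(i <- r | Q i) rho (F i) v.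
Proof.
apply: (big_morph (rho^~ v) (fun a b => rep_mapD rho a b v)).
by rewrite -(scale0r 0) rep_mapZ scale0r.
Qed.

Definition pair_form (p q : X * H) : C := ph_ip p.2 (rho (ip p.1 q.1) q.2).

Definition tensor_form (s t : seq (X * H)) : C :=
  \sum_(p <- s) \sum_(q <- t) pair_form p q.

Lemma pair_form_herm p q : pair_form p q = (pair_form q p)^*.
Proof. by rewrite /pair_form -ph_ip_herm rep_map_star -(rip_star ipP). Qed.

Lemma tensor_form_herm s t : tensor_form s t = (tensor_form t s)^*.
Proof.
rewrite /tensor_form exchange_big rmorph_sum; apply: eq_bigr => q _.
by rewrite rmorph_sum; apply: eq_bigr => p _; rewrite pair_form_herm.
Qed.

Lemma tensor_form_catr s t u :
  tensor_form s (t ++ u) = tensor_form s t + tensor_form s u.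
Proof.
by rewrite -big_split; apply: eq_bigr => p _; rewrite big_cat.
Qed.

(** Invariance is needed in the right argument only; Hermitian symmetry transfers it to the left
    one. *)
Lemma tensor_form_eqr s t u : tensor_eq rho t u ->
  tensor_form s t = tensor_form s u.
Proof.
elim=> {t u}.
- by [].
- by move=> t u _ ->.
- by move=> t u v _ -> _ ->.
- by move=> t t' u u' _ e1 _ e2; rewrite !tensor_form_catr e1 e2.
- by move=> t u; rewrite !tensor_form_catr addrC.
- move=> v; apply: eq_bigr => p _; rewrite big_seq1 big_nil /pair_form /=.
  have -> : ip p.1 0 = 0 by rewrite -(scale0r 0) (rip_scale ipP) scale0r.
  by rewrite -(scale0r 0) rep_mapZ scale0r ph_ip0.
- move=> x y v; apply: eq_bigr => p _; rewrite big_seq1 big_cons big_seq1.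
  by rewrite /pair_form /= (rip_add ipP) rep_mapD ph_ipD.
- move=> x v w; apply: eq_bigr => p _; rewrite big_seq1 big_cons big_seq1.
  by rewrite /pair_form /= linearD ph_ipD.
- move=> z x v; apply: eq_bigr => p _; rewrite !big_seq1.
  by rewrite /pair_form /= (rip_scale ipP) rep_mapZ linearZ.
- move=> a x v; apply: eq_bigr => p _; rewrite !big_seq1.
  by rewrite /pair_form /= (rip_act ipP) rep_mapM.
Qed.

Lemma tensor_form_eq s s' t t' : tensor_eq rho s s' ->
  tensor_eq rho t t' -> tensor_form s t = tensor_form s' t'.
Proof.
move=> ss tt; rewrite (tensor_form_eqr _ tt) tensor_form_herm.
by rewrite (tensor_form_eqr _ ss) -tensor_form_herm.
Qed.

(** The double sum equals the sum over [r] of the squared norms of [\sum_i rho (b r i) (v i)]. *)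
Lemma tensor_form_sos (I : finType) (m : nat) (b : I -> 'I_m -> A)
    (v : 'I_m -> H) :
  0 <= \sum_i \sum_j ph_ip (v i) (rho (\sum_r (b r i)^† ** b r j) (v j)).
Proof.
have -> : \sum_i \sum_j ph_ip (v i) (rho (\sum_r (b r i)^† ** b r j) (v j)) =
    \sum_r ph_ip (\sum_i rho (b r i) (v i)) (\sum_i rho (b r i) (v i)).
  under eq_bigr do under eq_bigr do rewrite rep_map_sum ph_ip_sum.
  under eq_bigr do rewrite exchange_big.
  rewrite exchange_big; apply: eq_bigr => r _.
  rewrite ph_ip_suml; apply: eq_bigr => i _; rewrite ph_ip_sum.
  by apply: eq_bigr => j _; rewrite rep_mapM rep_map_star.
by apply: sumr_ge0 => r _; exact: ph_ip_ge0.
Qed.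

End Form.

(** Every tensor is a finite sum of elementary ones, so positivity on the tensor product reduces to
    Gram matrices of finite families. *)
Lemma property_P_nonneg :
  (forall (H : preHilbert C) (rho : starRepresentation A H) m
     (x : 'I_m -> X) (v : 'I_m -> H),
     0 <= \sum_i \sum_j ph_ip (v i) (rho (ip (x i) (x j)) (v j))) ->
  property_P ip.
Proof.
move=> pos H rho; exists (fun s t => tensor_form rho (repr s) (repr t)).
have FE s t : tensor_form rho (repr (\pi_(tensor X rho) s)%qT) (repr (\pi_(tensor X rho) t)%qT) =
    tensor_form rho s t by apply: tensor_form_eq; exact: tensor_repr.
split.
- split.
  + move=> s t u.
    have -> : t + u = (\pi_(tensor X rho) (repr t ++ repr u))%qT by [].
    by rewrite -tensor_form_catr; apply: tensor_form_eqr; exact: tensor_repr.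
  + move=> z s t.
    have -> : z *: t = (\pi_(tensor X rho) [seq (z *: p.1, p.2) | p <- repr t])%qT.
      by [].
    rewrite (tensor_form_eqr _ (tensor_repr _ _)) /tensor_form mulr_sumr.
    apply: eq_bigr => p _; rewrite big_map mulr_sumr; apply: eq_bigr => q _.
    by rewrite /pair_form /= (rip_scale ipP) rep_mapZ ph_ipZ.
  + by move=> s t; exact: tensor_form_herm.
- by move=> x v y w; rewrite FE /tensor_form !big_seq1.
- move=> t; move: (repr t) => s; rewrite /tensor_form.
  have := pos H rho (size s) (fun i => (tnth (in_tuple s) i).1) (fun i => (tnth (in_tuple s) i).2).
  congr (0 <= _); rewrite [RHS](big_tnth _ _ s); apply: eq_bigr => i _.
  by rewrite [RHS](big_tnth _ _ s).
Qed.

End TensorForm.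

(** * Cholesky factorization over smooth functions *)

Section SmoothCholesky.
Variables (R : realType) (n : nat) (M : smoothManifold R n).
Local Notation C := R[i].
Local Notation "x %:C" := (real_complex R x) : ring_scope.
Local Notation A := (smooth_fun_algebra M).

Lemma conjCM (z w : C) : (z * w)^* = z^* * w^*.
Proof. exact: rmorphM. Qed.

Lemma conjCD (z w : C) : (z + w)^* = z^* + w^*.
Proof. exact: rmorphD. Qed.

Lemma conjCB (z w : C) : (z - w)^* = z^* - w^*.
Proof. exact: rmorphB. Qed.

Lemma conjC_sum (I : Type) (r : seq I) (P : pred I) (F : I -> C) :
  (\sum_(i <- r | P i) F i)^* = \sum_(i <- r | P i) (F i)^*.
Proof. exact: rmorph_sum. Qed.

Lemma complex_ge0_real (z : C) : 0 <= z -> z = (complex.Re z)%:C.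
Proof. by move=> z0; rewrite RRe_real// ger0_real. Qed.

Definition smooth_const (z : C) : A :=
  @Sections _ _ _ (smooth_fun_subspace M) _ (@smooth_on_cst _ _ M setT z).

Lemma positive_sqrt (f : A) : (forall x, 0 < (f x : C)) ->
  exists r s : A, forall x, [/\ (r x : C)^* = r x, (s x : C)^* = s x,
    (r x : C) * r x = f x & (s x : C) * r x = 1].
Proof.
move=> f0; pose g x := complex.Re (f x : C).
have fE x : (f x : C) = (g x)%:C by apply: complex_ge0_real; exact: ltW.
have g0 x : 0 < g x by rewrite -ltcR -fE.
have sg : rsmooth setT g.
  by apply: (smooth_on_ext openT _ (sec_pred f)) => x _; exact: fE.
have sr := rsmooth_sqrt openT (fun x _ => g0 x) sg.
have r0 x : Num.sqrt (g x) != 0 by rewrite gt_eqF// sqrtr_gt0.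
have ss := rsmoothV openT (fun x _ => r0 x) sr.
exists (@Sections _ _ _ (smooth_fun_subspace M) _ sr).
exists (@Sections _ _ _ (smooth_fun_subspace M) _ ss) => x /=; split.
- exact: conjc_real.
- exact: conjc_real.
- by rewrite -rmorphM -expr2 sqr_sqrtr ?ltW// -fE.
- by rewrite -rmorphM mulVf.
Qed.

Definition smooth_posdef m (H : 'I_m -> 'I_m -> A) : Prop :=
  (forall i j x, (H i j x : C) = (H j i x : C)^*) /\
  forall x (v : 'I_m -> C), (exists i, v i != 0) ->
    0 < \sum_i \sum_j (v i)^* * (H i j x * v j).

(* Induction by Schur complements. *)
Lemma smooth_cholesky m (H : 'I_m -> 'I_m -> A) : smooth_posdef H ->
  exists b : 'I_m -> 'I_m -> A,
    forall i j, H i j = \sum_r (b r i)^† ** b r j.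
Proof.
elim: m H => [|m ih] H [hH pH]; first by exists H => -[].
have a0 x : 0 < (H ord0 ord0 x : C).
  have := pH x (fun i => (i == ord0)%:R).
  rewrite (bigD1 ord0)//= [X in _ + X]big1 => [|i /negbTE ->]; last first.
    by rewrite big1// => j _; rewrite rmorph0 mul0r.
  rewrite (bigD1 ord0)//= [X in _ + X + _]big1 => [|i /negbTE ->]; last first.
    by rewrite !mulr0.
  rewrite rmorph1 mul1r mulr1 !addr0; apply.
  by exists ord0; rewrite oner_eq0.
have [r [s rs]] := positive_sqrt a0.
have [c cE] : exists c : 'I_m.+1 -> A, forall q x, (c q x : C) = s x * H ord0 q x.
  by exists (fun j => s ** H ord0 j).
(* The Schur complement of the corner entry; [c] is the first row of the factor, namely the first
   row of [H] divided by the square root of the corner. *)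
pose K (i j : 'I_m) : A := H (lift ord0 i) (lift ord0 j) -
  (c (lift ord0 i))^† ** c (lift ord0 j).
have KE i j x : (K i j x : C) = H (lift ord0 i) (lift ord0 j) x -
    (c (lift ord0 i) x : C)^* * c (lift ord0 j) x.
  rewrite -[LHS]/(H (lift ord0 i) (lift ord0 j) x +
    (-1) *: ((c (lift ord0 i) x : C)^* * c (lift ord0 j) x : C)).
  by rewrite scaleN1r.
have [|b hb] := ih K.
  split=> [i j x|x v [i0 vi0]].
    by rewrite !KE conjCB conjCM conjCK -hH [X in _ - X]mulrC.
  pose S : C := \sum_j H ord0 (lift ord0 j) x * v j.
  (* The first coordinate minimizes the form of [H] for fixed [v]; the minimum is the form of [K] at
     [v], which is thus positive. *)
  pose w i : C := if unlift ord0 i is Some j then v j else - S / H ord0 ord0 x.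
  have w0 : w ord0 = - S / H ord0 ord0 x by rewrite /w unlift_none.
  have wl j : w (lift ord0 j) = v j by rewrite /w liftK.
  have := pH x w; have -> : \sum_i \sum_j (w i)^* * (H i j x * w j) =
      \sum_i \sum_j (v i)^* * (K i j x * v j).
    have [hr hs rr sr] := rs x.
    have w0E : w ord0 = - (s x * s x) * S.
      rewrite w0 -rr mulNr [in RHS]mulNr; congr (- _).
      have r0 : (r x : C) != 0 by apply: contra_eq_neq sr => ->; rewrite mulr0 eq_sym oner_neq0.
      have -> : (s x : C) = (r x)^-1 by rewrite -[LHS]mulr1 -(mulfV r0) mulrA sr mul1r.
      by rewrite mulrC invfM.
    have Sc : S^* = \sum_i (v i)^* * H (lift ord0 i) ord0 x.
      rewrite conjC_sum; apply: eq_bigr => i _.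
      by rewrite conjCM -hH mulrC.
    have ssa : s x * s x * H ord0 ord0 x = 1 :> C.
      by rewrite -rr mulrACA sr mulr1.
    rewrite big_ord_recl big_ord_recl.
    have -> : \sum_i (w ord0)^* * (H ord0 (lift ord0 i) x * w (lift ord0 i)) =
        (w ord0)^* * S :> C.
      by rewrite mulr_sumr; apply: eq_bigr => i _; rewrite wl.
    have -> : \sum_i \sum_j (w (lift ord0 i))^* * (H (lift ord0 i) j x * w j) =
        S^* * w ord0 + \sum_i \sum_j (v i)^* *
          (H (lift ord0 i) (lift ord0 j) x * v j) :> C.
      rewrite Sc mulr_suml -big_split; apply: eq_bigr => i _.
      rewrite big_ord_recl wl mulrA; congr (_ + _); apply: eq_bigr => j _.
      by rewrite wl.
    have -> : \sum_i \sum_j (v i)^* * (K i j x * v j) =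
        \sum_i \sum_j (v i)^* * (H (lift ord0 i) (lift ord0 j) x * v j) -
        s x * s x * (S^* * S) :> C.
      have -> : s x * s x * (S^* * S) = \sum_i \sum_j (v i)^* *
          ((c (lift ord0 i) x : C)^* * c (lift ord0 j) x * v j) :> C.
        rewrite Sc mulr_suml mulr_sumr; apply: eq_bigr => i _.
        rewrite !mulr_sumr; apply: eq_bigr => j _.
        by rewrite !cE conjCM hs -hH; ring.
      rewrite -sumrB; apply: eq_bigr => i _; rewrite -sumrB; apply: eq_bigr => j _.
      by rewrite KE mulrBl mulrBr.
    have sN : (- (s x * s x))^* = - (s x * s x) :> C.
      by rewrite -sub0r conjCB conjC0 conjCM hs.
    rewrite w0E conjCM sN.
    set q := S^* in w0E Sc *; set T := \sum_i \sum_j _.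
    have -> : - (s x * s x) * q * (H ord0 ord0 x * (- (s x * s x) * S)) =
        s x * s x * H ord0 ord0 x * (s x * s x) * (q * S) :> C by ring.
    by rewrite ssa; ring.
  by apply; exists (lift ord0 i0); rewrite wl.
(* Block factor: first row [c], then [b] preceded by a zero column. *)
exists (fun q j => if unlift ord0 q is Some q' then
  (if unlift ord0 j is Some j' then b q' j' else 0) else c j) => i j.
rewrite big_ord_recl unlift_none.
under eq_bigr do rewrite liftK.
apply: sectionsP => x; have [hr hs rr sr] := rs x.
have sumE : ((\sum_(q < m) (if unlift ord0 i is Some i' then b q i' else 0)^† **
    (if unlift ord0 j is Some j' then b q j' else 0)) x : C) =
    if unlift ord0 i is Some i' then
      if unlift ord0 j is Some j' then K i' j' x else 0
    else 0.
  case: unliftP => [i' _|_]; last first.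
    by rewrite sections_sumE big1// => q _ /=; rewrite conjC0 mul0r.
  case: unliftP => [j' _|_]; first by rewrite hb.
  by rewrite sections_sumE big1// => q _ /=; rewrite mulr0.
rewrite -[RHS]/((c i x : C)^* * c j x +
  (\sum_(q < m) (if unlift ord0 i is Some i' then b q i' else 0)^† **
    (if unlift ord0 j is Some j' then b q j' else 0)) x) sumE.
have ssa : s x * s x * H ord0 ord0 x = 1 :> C by rewrite -rr mulrACA sr mulr1.
have Hc q : (H q ord0 x : C)^* = H ord0 q x by rewrite -hH.
case: unliftP => [i' ->|->]; last first.
  by rewrite addr0 !cE conjCM hs Hc -[LHS]mul1r -ssa; ring.
case: unliftP => [j' ->|->]; last first.
  by rewrite addr0 !cE conjCM hs -hH -[LHS]mul1r -ssa; ring.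
by rewrite KE addrC subrK.
Qed.
End SmoothCholesky.

Lemma conj_right_inner_product (C : numClosedFieldType) (B A : starAlgebra C)
    (X : bimodule B A) (ip : X -> X -> B) : left_inner_product ip ->
  @right_inner_product C A B (conj_bimodule X) (fun x y => ip x y).
Proof.
move=> ipP; split.
- move=> x y z; rewrite (lip_star ipP x (y + z)) (lip_add ipP) sa_starD.
  by rewrite -!(lip_star ipP).
- move=> c x y; rewrite -[c *: y]/(c^* *: (y : X)).
  by rewrite (lip_star ipP) (lip_scale ipP) sa_starZ conjCK -(lip_star ipP).
- move=> x y b; rewrite -[y <* b]/(b^† *> (y : X)).
  by rewrite (lip_star ipP) (lip_act ipP) sa_starM sa_starK -(lip_star ipP).
- by move=> x y; exact: (lip_star ipP).
Qed.

(** Passage to the limit [e -> 0]; as [c] is real, one value of [e] already forces [z] to be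
    real. *)
Lemma ge0_approx (R : realType) (z c : R[i]) : 0 <= c ->
  (forall e : R, 0 < e -> 0 <= z + real_complex R e * c) -> 0 <= z.
Proof.
case: z c => [a b] [p q] c0 h.
have [qE p0] : q = 0 /\ 0 <= p by move: c0; rewrite lecE /= => /andP[/eqP -> ->].
have h' (e : R) : 0 < e -> b = 0 /\ 0 <= a + e * p.
  move=> /h; rewrite lecE /= qE !(mulr0, mul0r, addr0, subr0).
  by move=> /andP[/eqP -> ->].
have [-> _] := h' 1 ltr01.
rewrite lecE /= eqxx /=; apply/ler_addgt0Pr => e e0.
(* The denominator is [p + 1] because [p] may vanish. *)
have p1 : 0 < p + 1 by rewrite ltr_wpDl.
have [_ /le_trans] := h' (e / (p + 1)) (divr_gt0 e0 p1); apply.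
rewrite lerD2l mulrAC ler_pdivrMr// ler_pM2l// lerDl//.
Qed.

(** * The function-valued inner product *)

Section HermitianBundle.
Variables (R : realType) (n k : nat) (M : smoothManifold R n).
Variables (E : vectorBundle M k) (h : hermitianMetric E).
Local Notation C := R[i].
Local Notation "x %:C" := (real_complex R x) : ring_scope.
Local Notation A := (smooth_fun_algebra M).
Local Notation B := (endo_algebra h).
Local Notation X := (section_bimodule h).
Local Notation ipA := (@section_metric R n M k E h).
Local Notation ipB := (@section_rank_one R n M k E h).

Lemma hm_ge0 x (u : E x) : 0 <= h x u u.
Proof. by have [->|/(hm_pos h)/ltW//] := eqVneq u 0; rewrite hm0. Qed.

Lemma section_metric_rip : right_inner_product ipA.
Proof.
split=> [x y z|c x y|x y a|x y]; apply: sectionsP => p /=.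
- exact: hmD.
- exact: hmZ.
- by rewrite hmZ mulrC.
- exact: hm_herm.
Qed.

Lemma section_rank_one_lip : left_inner_product ipB.
Proof.
split=> [x y z|c x y|b x y|x y]; apply: sectionsP => p /=.
- by apply/lfunP => w; rewrite add_lfunE !fiber_rank_oneE; exact: scalerDr.
- apply/lfunP => w; rewrite scale_lfunE !fiber_rank_oneE.
  rewrite -[LHS]/(h p ((y : Gamma E) p) w *: (c *: (x : Gamma E) p)).
  by rewrite !scalerA mulrC.
- by apply/lfunP => w; rewrite comp_lfunE !fiber_rank_oneE linearZ.
- apply/esym/fiber_adjoint_eq => v w; rewrite !fiber_rank_oneE hmZl hmZ.
  by rewrite -(hm_herm h) mulrC.
Qed.

Lemma section_metric_adj b x y : ipA (b *> x : X) y = ipA x (b^† *> y : X).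
Proof. by apply: sectionsP => p /=; rewrite fiber_adjointPr. Qed.

Lemma section_rank_one_adj x y a : ipB (x <* a : X) y = ipB x (y <* a^† : X).
Proof.
apply: sectionsP => p /=; apply/lfunP => w; rewrite !fiber_rank_oneE hmZl conjCK.
by rewrite scalerA mulrC.
Qed.

Lemma section_compat (x y z : X) : x <* ipA y z = ipB x y *> z.
Proof. by apply: sectionsP => p /=; rewrite fiber_rank_oneE. Qed.

Lemma smooth_const1 : (smooth_const M 1)^† ** smooth_const M 1 = smooth_const M 1.
Proof. by apply: sectionsP => p /=; rewrite conjC1 mulr1. Qed.

(** A smooth nonnegative function may lack a smooth square root, but [ipA x x] plus a positive
    constant [e] has one and is therefore a square [r^† ** r]. *)
Lemma section_metric_psd : ip_psd ipA.
Proof.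
move=> x; split; first by rewrite -(rip_star section_metric_rip).
move=> w wpos; apply: (@ge0_approx _ _ (w (smooth_const M 1))).
  by rewrite -smooth_const1; exact: wpos.
move=> e e0; have [|r [s rs]] := @positive_sqrt _ _ M (ipA x x + smooth_const M e%:C).
  move=> p; rewrite -[_ p]/(h p ((x : Gamma E) p) ((x : Gamma E) p) + e%:C).
  by rewrite ltr_wpDl ?ltcR//; exact: hm_ge0.
have -> : w (ipA x x) + e%:C * w (smooth_const M 1) = w (r^† ** r).
  have -> : r^† ** r = ipA x x + e%:C *: smooth_const M 1.
    apply: sectionsP => p; have [hr _ rr _] := rs p.
    rewrite -[LHS]/((r p : C)^* * r p) hr rr; congr (_ + _).
    by rewrite -[RHS]/(e%:C * 1) mulr1.
  by rewrite linearD linearZ.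
exact: wpos.
Qed.

(** The Gram matrix plus [e] times the identity is pointwise positive definite, so its Cholesky
    factorization turns the form into a sum of squares. *)
Lemma section_metric_P : property_P ipA.
Proof.
apply: (property_P_nonneg section_metric_rip) => H rho m x v.
(* Representations need not be unital, so the error term involves [rho] of the constant 1, which is
   positive because that constant is its own square. *)
apply: (@ge0_approx _ _ (\sum_i ph_ip (v i) (rho (smooth_const M 1) (v i)))).
  apply: sumr_ge0 => i _.
  by rewrite -smooth_const1 rep_mapM -(sa_starK (_^†)) -rep_map_star sa_starK ph_ip_ge0.
move=> e e0.
pose G (i j : 'I_m) : A := ipA (x i) (x j) + (e%:C * (i == j)%:R) *: smooth_const M 1.
have [|b hb] := @smooth_cholesky _ _ M m G.
  split=> [i j p|p a [i0 ai0]].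
    rewrite -[LHS]/(h p (x i p) (x j p) + e%:C * (i == j)%:R * 1).
    rewrite -[RHS]/((h p (x j p) (x i p) + e%:C * (j == i)%:R * 1)^*).
    rewrite conjCD -(hm_herm h); congr (_ + _).
    by rewrite !mulr1 [RHS]conjCM conjC_nat eq_sym; congr (_ * _); rewrite [RHS]conjc_real.
  pose y : E p := \sum_i a i *: (x i : Gamma E) p.
  have -> : \sum_i \sum_j (a i)^* * (G i j p * a j) =
      h p y y + e%:C * \sum_i (a i)^* * a i.
    rewrite {1}/y hm_suml mulr_sumr -big_split; apply: eq_bigr => i _ /=.
    rewrite hmZl /y hm_sum mulr_sumr.
    transitivity (\sum_j ((a i)^* * h p (x i p) (a j *: (x j : Gamma E) p) +
        (a i)^* * (e%:C * (i == j)%:R * a j))).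
      apply: eq_bigr => j _; rewrite hmZ.
      rewrite -[LHS]/((a i)^* * ((h p (x i p) (x j p) + e%:C * (i == j)%:R * 1) * a j)).
      by rewrite mulr1; ring.
    rewrite big_split /=; congr (_ + _).
    rewrite (bigD1 i)//= big1 ?addr0 => [|j ji].
      by rewrite eqxx mulr1; ring.
    by rewrite eq_sym (negbTE ji) mulr0 mul0r mulr0.
  apply: ltr_wpDl.
    exact: hm_ge0.
  rewrite mulr_gt0 ?ltcR// (bigD1 i0)//= ltr_pwDl//.
    by rewrite mulrC mul_conjC_gt0.
  by apply: sumr_ge0 => i _; rewrite mulrC mul_conjC_ge0.
have := tensor_form_sos rho b v; congr (0 <= _).
rewrite mulr_sumr -big_split; apply: eq_bigr => i _.
rewrite (bigD1 i)//= [in RHS](bigD1 i)//= addrAC -!hb /G; congr (_ + _).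
  by rewrite rep_mapD rep_mapZ eqxx mulr1 ph_ipD ph_ipZ.
apply: eq_bigr => j ji; rewrite -hb /G eq_sym (negbTE ji) mulr0 scale0r addr0.
by [].
Qed.

End HermitianBundle.

(** * Fullness and the endomorphism-valued inner product *)

Section FullInnerProducts.
Variables (R : realType) (n k : nat) (M : smoothManifold R n).
Variables (E : vectorBundle M k) (h : hermitianMetric E).
Local Notation C := R[i].
Local Notation "x %:C" := (real_complex R x) : ring_scope.
Local Notation A := (smooth_fun_algebra M).
Local Notation B := (endo_algebra h).
Local Notation X := (section_bimodule h).
Local Notation ipA := (@section_metric R n M k E h).
Local Notation ipB := (@section_rank_one R n M k E h).

Lemma spanning_orthogonal (I : finType) x (v : I -> E x) w : spanning v ->
  (forall i, h x (v i) w = 0) -> w = 0.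
Proof.
move=> sv vw; apply: (hm_eq0 (h := h)); have [a {1}->] := sv w.
by rewrite hm_suml big1// => i _; rewrite hmZl vw mulr0.
Qed.

(** In a trivialization the matrix of the inverse is the inverse matrix, whose entries are smooth by
    the adjugate formula. *)
Lemma endo_inverse_smooth (S : GammaEnd E) :
  (forall x, lker (S x) == 0%VS) -> smooth_endo (fun x => (S x)^-1%VF).
Proof.
move=> S0 t At i j; have oU := @tr_dom_open _ _ _ _ _ t.
pose Sm x : 'M[C]_k := \matrix_(i, j) tr_coord t i (S x (tr_frame t j x)).
pose T x : 'M[C]_k := \matrix_(i, j) tr_coord t i ((S x)^-1%VF (tr_frame t j x)).
have ST x : tr_dom t x -> Sm x *m T x = 1%:M.
  move=> tx; apply/matrixP => a b; rewrite [RHS]mxE -(tr_coord_frame a b tx).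
  rewrite -[in RHS](lker0_lfunVK (S0 x) (tr_frame t b x)).
  rewrite [X in S x X](tr_frame_span _ tx) linear_sum tr_coord_sum mxE.
  by apply: eq_bigr => l _; rewrite linearZ tr_coordZ !mxE mulrC.
have uS x : tr_dom t x -> Sm x \in unitmx by move=> /ST/mulmx1_unit[].
apply: (smooth_on_ext oU _ (smooth_on_invmx oU uS _ i j)) => [x tx|a b].
  transitivity (T x i j); last by rewrite mxE.
  by rewrite -[T x]mul1mx -(mulVmx (uS x tx)) -mulmxA ST// mulmx1.
by apply: (smooth_on_ext oU _ (sec_pred S t At a b)) => x _; rewrite mxE.
Qed.

Lemma section_rank_one_full : ip_full ipB.
Proof.
move=> b; have [I [s hs]] := finite_generators E.
pose S : GammaEnd E := \sum_i (ipB (s i) (s i) : GammaEnd E).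
have SE x w : S x w = \sum_i h x (s i x) w *: s i x.
  rewrite /S sections_sumE sum_lfunE; apply: eq_bigr => i _.
  exact: fiber_rank_oneE.
(* The number [h x z (S x z)] is the sum of the squared moduli of [h x (s i x) z]; if it vanishes,
   [z] is orthogonal to a spanning family. *)
have S0 x : lker (S x) == 0%VS.
  apply/lker0P => v w vw; apply/eqP; rewrite -subr_eq0; apply/eqP.
  have : S x (v - w) = 0 by rewrite linearB /= vw subrr.
  move: (v - w) => z Sz; apply: (spanning_orthogonal (hs x)) => i.
  have : h x z (S x z) = 0 by rewrite Sz hm0.
  rewrite SE hm_sum; have nn j : true -> 0 <= h x z (h x (s j x) z *: s j x).
    by move=> _; rewrite hmZ (hm_herm h z) mul_conjC_ge0.
  move/eqP; rewrite psumr_eq0// => /allP/(_ i (mem_index_enum _)).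
  by rewrite hmZ (hm_herm h z) mul_conjC_eq0 => /eqP.
pose T : GammaEnd E := @Sections _ _ _ (endo_subspace E) _ (endo_inverse_smooth S0).
exists [seq (1, (endo_apply (endo_comp b T) (s i), s i)) | i <- enum I].
rewrite big_map big_enum /=; apply: sectionsP => x; apply/lfunP => w.
transitivity ((\sum_i (ipB (endo_apply (endo_comp b T) (s i)) (s i) : GammaEnd E)) x w).
  rewrite sections_sumE sum_lfunE.
  transitivity ((b : GammaEnd E) x (T x (S x w))).
    by rewrite /= lker0_lfunK.
  rewrite SE !linear_sum; apply: eq_bigr => i _.
  by rewrite [RHS]fiber_rank_oneE !linearZ /= comp_lfunE.
congr ((_ : GammaEnd E) x w); apply: eq_bigr => i _; rewrite scale1r.
by [].
Qed.

Hypothesis k_gt0 : (1 <= k)%N.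

Lemma unit_frame : exists (I : finType) (u : I -> X),
  \sum_i ipA (u i) (u i) = smooth_const M 1.
Proof.
have [I [s hs]] := finite_generators E.
pose g : A := \sum_i ipA (s i : X) (s i : X).
have gE x : (g x : C) = \sum_i h x (s i x) (s i x) by rewrite /g sections_sumE.
have g0 x : 0 < (g x : C).
  have gg : 0 <= (g x : C) by rewrite gE; apply: sumr_ge0 => i _; exact: hm_ge0.
  rewrite lt_neqAle gg andbT eq_sym; apply/eqP => gx.
  have [t At tx] := vb_cover E x.
  (* Since [k >= 1] there is a first frame vector; if [g] vanished at [x], it would be orthogonal to
     all [s i x], hence zero. *)
  have := tr_coord_frame (Ordinal k_gt0) (Ordinal k_gt0) tx.
  rewrite eqxx (spanning_orthogonal (w := tr_frame t (Ordinal k_gt0) x) (hs x)) => [|i].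
    by rewrite tr_coord0 => /esym/eqP; rewrite oner_eq0.
  move: gx; rewrite gE => /eqP; rewrite psumr_eq0 => [|j _]; last exact: hm_ge0.
  move=> /allP/(_ i (mem_index_enum _))/eqP/(hm_eq0 (h := h)) ->.
  exact: hm0l.
have [r [q rq]] := positive_sqrt g0.
exists I, (fun i => (s i : X) <* q); apply: sectionsP => x.
have [_ hq rr qr] := rq x.
rewrite sections_sumE; transitivity (\sum_i (q x : C) * q x * h x (s i x) (s i x)).
  apply: eq_bigr => i _.
  rewrite -[LHS]/(h x ((q x : C) *: s i x) ((q x : C) *: s i x)).
  by rewrite hmZl hmZ hq mulrA.
by rewrite -mulr_sumr -gE -rr mulrACA qr mulr1.
Qed.

(** With [u] from [unit_frame], [f] is the sum of the [ipA (u i) (u i <* f)]. *)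
Lemma section_metric_full : ip_full ipA.
Proof.
move=> f; have [I [u hu]] := unit_frame.
exists [seq (1, (u i, u i <* f)) | i <- enum I].
rewrite big_map big_enum /=.
transitivity (smooth_const M 1 ** f).
  by apply: sectionsP => x; rewrite -[RHS]/(1 * (f x : C)) mul1r.
rewrite -hu (big_morph (fun a : A => a ** f) (id1 := 0) (op1 := +%R)) => [|a b|].
- apply: eq_bigr => i _.
  by rewrite scale1r (rip_act (section_metric_rip h)).
- exact: sa_mulDl.
- by rewrite -(scale0r (0 : A)) sa_mulZl !scale0r.
Qed.

(** Composing the rank-one operators of [(x, u i)] and [(u i, y)] gives [h(u i, u i)] times that of
    [(x, y)], and these factors sum to 1. *)
Lemma rank_one_sos : exists (I : finType) (u : I -> X),
  forall x y : X, ipB x y = \sum_i (ipB (u i) x)^† ** ipB (u i) y.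
Proof.
have [I [u hu]] := unit_frame; exists I, u => x y.
under eq_bigr do rewrite -(lip_star (section_rank_one_lip h)).
apply: sectionsP => p; apply/lfunP => w.
rewrite sections_sumE sum_lfunE.
transitivity (\sum_i h p ((u i : Gamma E) p) ((u i : Gamma E) p) *:
   (h p ((y : Gamma E) p) w *: (x : Gamma E) p)).
  rewrite -scaler_suml; have := congr1 (fun a : A => a p : C) hu.
  rewrite sections_sumE /= => ->; rewrite scale1r.
  exact: fiber_rank_oneE.
apply: eq_bigr => i _; rewrite [RHS]comp_lfunE.
by rewrite !fiber_rank_oneE hmZ !scalerA mulrC.
Qed.

Lemma section_rank_one_psd : ip_psd ipB.
Proof.
move=> x; split; first by rewrite -(lip_star (section_rank_one_lip h)).
move=> w wpos; have [I [u hu]] := rank_one_sos; rewrite hu linear_sum.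
by apply: sumr_ge0 => i _; exact: wpos.
Qed.

(** By [rank_one_sos] the Gram matrix is exactly a sum of squares, so no approximation is required
    here. *)
Lemma section_rank_one_Q : property_Q ipB.
Proof.
apply: (property_P_nonneg (conj_right_inner_product (section_rank_one_lip h))).
move=> H rho m x v; have [I [u hu]] := rank_one_sos.
have := tensor_form_sos rho (fun i j => ipB (u i) (x j)) v; congr (0 <= _).
by apply: eq_bigr => i _; apply: eq_bigr => j _; rewrite -hu.
Qed.

End FullInnerProducts.

Theorem proposition6p7 (R : realType) (n k : nat) (M : smoothManifold R n)
    (E : vectorBundle M k) (h : hermitianMetric E) (hk : (1 <= k)%N) :
  @equivalence_bimodule R[i] (endo_algebra h) (smooth_fun_algebra M)
    (section_bimodule h) (@section_metric R n M k E h)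
    (@section_rank_one R n M k E h).
Proof.
split.
- exact: section_metric_rip.
- exact: section_rank_one_lip.
- exact: section_metric_psd.
- exact: section_rank_one_psd hk.
- exact: section_metric_full hk.
- exact: section_rank_one_full.
- exact: section_metric_adj.
- exact: section_rank_one_adj.
- exact: section_compat.
- exact: section_metric_P.
- exact: section_rank_one_Q hk.
Qed.
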